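(* Consider the D-ASG iterates $x^{(k+1)}=\mathcal{W}y^{(k)}-\alpha\tilde\nabla F(y^{(k)})$, $y^{(k)}=(1+\beta)x^{(k)}-\beta x^{(k-1)}$, $k\ge 0$, with $\alpha\in\left(0,\frac{\lambda_N^W}{L}\right]$ and $\beta=\frac{1-\sqrt{\alpha\mu}}{1+\sqrt{\alpha\mu}}$. If in addition $\alpha\le\frac{1}{L+\mu}$, then for any $k\ge0$, $$\mathbb{E}\left[\|x^{(k)}-x^*\|^2\right]\le4\left(1-\sqrt{\alpha\mu}\right)^k\frac{V_{S,\alpha}(\xi_0)}{\mu}+\frac{2\sigma^2N\sqrt\alpha}{\mu\sqrt\mu}\left(2-\lambda_N^W+\alpha L\right)+\frac{2C_1^2N\alpha^2}{(1-\gamma)^2}.$$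
   Context: Functions: $f_1,\dots,f_N:\mathbb{R}^d\to\mathbb{R}$ are each $\mu$-strongly convex with $L$-Lipschitz gradient ($0<\mu\le L$). $F:\mathbb{R}^{Nd}\to\mathbb{R}$, $F(x_1,\dots,x_N)=\sum_{i=1}^N f_i(x_i)$. $x_*\in\mathbb{R}^d$ is the unique minimizer of $f=\frac1N\sum_{i=1}^N f_i$ and $x^*=[x_*^T,\dots,x_*^T]^T\in\mathbb{R}^{Nd}$. Network: $(\mathcal V,\mathcal E)$ is a connected undirected graph on $\{1,\dots,N\}$; $W$ is a symmetric doubly stochastic $N\times N$ matrix with, for $i\ne j$, $W_{ij}>0$ if $(i,j)\in\mathcal E$ and $W_{ij}=0$ otherwise, and $W_{ii}=1-\sum_{j\neq i}W_{ij}>0$. Its eigenvalues are $1=\lambda_1^W>\lambda_2^W\ge\cdots\ge\lambda_N^W$, and it is assumed that $\lambda_N^W>0$. $\gamma:=\max\{|\lambda_2^W|,|\lambda_N^W|\}$; $\mathcal{W}:=W\otimes I_d$. Iterates: $x^{(k)},y^{(k)}\in\mathbb{R}^{Nd}$ stack the node variables $x_i^{(k)},y_i^{(k)}\in\mathbb{R}^d$; $x^{(0)},x^{(-1)}$ are deterministic; $\tilde\nabla F(y^{(k)})$ stacks the stochastic gradients $\tilde\nabla f_i(y_i^{(k)})=\tilde\nabla f_i(y_i^{(k)},w_i^{(k)})$. Noise: $w_i^{(k)}$ is a random variable independent of all $w_j^{(t)}$ with $t<k$ and of $w_j^{(k)}$, $j\neq i$, and $\mathbb{E}[\tilde\nabla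 f_i(y_i^{(k)},w_i^{(k)})\,|\,y_i^{(k)}]=\nabla f_i(y_i^{(k)})$, $\mathbb{E}[\|\tilde\nabla f_i(y_i^{(k)},w_i^{(k)})-\nabla f_i(y_i^{(k)})\|^2\,|\,y_i^{(k)}]\le\sigma^2$. Penalized objective: $F_{\mathcal W,\alpha}(x):=\frac{1}{2\alpha}x^T(I_{Nd}-\mathcal W)x+F(x)$, with unique minimizer $x^\infty\in\mathbb{R}^{Nd}$. Lyapunov function: $V_{S,\alpha}(\xi):=\xi^TS_\alpha\xi+F_{\mathcal W,\alpha}(T\xi+x^\infty)-F_{\mathcal W,\alpha}(x^\infty)$ for $\xi\in\mathbb{R}^{2Nd}$, with $T=[1\ \ 0]\otimes I_{Nd}$, $S_\alpha=\tilde S_\alpha\otimes I_{Nd}$, $\tilde S_\alpha=vv^T$, $v=\left[\frac{1}{\sqrt{2\alpha}},\ \sqrt{\frac{\mu}{2}}-\sqrt{\frac{1}{2\alpha}}\right]^T$; $\xi_0=[(x^{(0)}-x^\infty)^T,(x^{(-1)}-x^\infty)^T]^T$. Constant: $C_1:=\sqrt{2L\sum_{i=1}^N(f_i(0)-f_i^* )}\cdot\left(1+\frac{2(L+\mu)}{\mu}\right)$ with $f_i^*:=\min_{x\in\mathbb{R}^d}f_i(x)$. *)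

(* Defs.v *)
(* MathComp-Analysis.  Vectors of R^(N d) are column vectors indexed as in the
   Kronecker product [*t] of mxtens; [stack] and [block] follow that indexing. *)
From HB Require Import structures.
From mathcomp Require Export all_boot all_order all_algebra.
From mathcomp Require Export all_classical all_reals all_analysis.
From mathcomp.real_closed Require Export mxtens.

Set Implicit Arguments.
Unset Strict Implicit.
Unset Printing Implicit Defensive.

Export Order.TTheory GRing.Theory Num.Theory.
Export numFieldNormedType.Exports.

Local Open Scope classical_set_scope.
Local Open Scope ring_scope.

Section Euclidean.
Context {R : realType}.

(* The library norm on matrices is the sup norm, hence a separate Euclidean
   norm. *)
Definition sqnorm n (x : 'cV[R]_n) : R := \sum_i x i 0 ^+ 2.
Definition enorm n (x : 'cV[R]_n) : R := Num.sqrt (sqnorm x).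

Definition qform n (A : 'M[R]_n) (x : 'cV[R]_n) : R := (x^T *m A *m x) 0 0.

Definition grad n (f : 'cV[R]_n -> R) (x : 'cV[R]_n) : 'cV[R]_n :=
  \col_i 'D_(delta_mx i 0) f x.

Definition strongly_convex n (mu : R) (f : 'cV[R]_n -> R) : Prop :=
  forall (x y : 'cV[R]_n) (t : R), 0 <= t <= 1 ->
    f (t *: x + (1 - t) *: y) <=
      t * f x + (1 - t) * f y - mu / 2 * t * (1 - t) * enorm (x - y) ^+ 2.

Definition lipschitz_gradient n (L : R) (f : 'cV[R]_n -> R) : Prop :=
  (forall x, differentiable f x) /\
  forall x y, enorm (grad f x - grad f y) <= L * enorm (x - y).

Definition unique_minimizer n (f : 'cV[R]_n -> R) (x : 'cV[R]_n) : Prop :=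
  forall z, z != x -> f x < f z.

Definition is_min_value n (f : 'cV[R]_n -> R) (m : R) : Prop :=
  (exists z, f z = m) /\ forall z, m <= f z.

Definition stack N d (u : 'I_N -> 'cV[R]_d) : 'cV[R]_(N * d) :=
  \col_k u (mxtens_unindex k).1 (mxtens_unindex k).2 0.

Definition block N d (x : 'cV[R]_(N * d)) (i : 'I_N) : 'cV[R]_d :=
  \col_j x (mxtens_index (i, j)) 0.

End Euclidean.

Section Network.
Context {R : realType} {N : nat}.

Definition connected_graph (E : rel 'I_N) : Prop :=
  symmetric E /\ forall i j, connect E i j.

(* Nonnegativity of the entries follows from the last two clauses. *)
Definition mixing_matrix (E : rel 'I_N) (W : 'M[R]_N) : Prop :=
  [/\ W^T = W,
      forall i, \sum_j W i j = 1,
      forall i j, i != j ->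
        (E i j -> 0 < W i j) /\ (~~ E i j -> W i j = 0) &
      forall i, 0 < W i i].

(* Eigenvalues listed with multiplicity, in nonincreasing order; with the
   usual 1-based indexing, lambda_j is [lam`_(j - 1)]. *)
Definition ordered_eigenvalues (W : 'M[R]_N) (lam : seq R) : Prop :=
  [/\ size lam = N, sorted >=%R lam &
      char_poly W = \prod_(l <- lam) ('X - l%:P)].

End Network.

Section Objectives.
Context {R : realType} {N d : nat}.
Implicit Types (f : 'I_N -> 'cV[R]_d -> R) (W : 'M[R]_N).

Definition average f (x : 'cV[R]_d) : R := N%:R^-1 * \sum_i f i x.

Definition Fsum f (x : 'cV[R]_(N * d)) : R := \sum_i f i (block x i).

Definition bigW W : 'M[R]_(N * d) := W *t 1%:M.

Definition Fpen f W (alpha : R) (x : 'cV[R]_(N * d)) : R :=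
  (2 * alpha)^-1 * qform (1%:M - bigW W) x + Fsum f x.

Definition vS (mu alpha : R) : 'cV[R]_2 :=
  \col_i if i == 0 then 1 / Num.sqrt (2 * alpha)
         else Num.sqrt (mu / 2) - Num.sqrt (1 / (2 * alpha)).

Definition Smat (mu alpha : R) : 'M[R]_(2 * (N * d)) :=
  (vS mu alpha *m (vS mu alpha)^T) *t 1%:M.

(* The cast identifies the dimension [1 * (N * d)] with [N * d]. *)
Definition Tmat : 'M[R]_(N * d, 2 * (N * d)) :=
  castmx (mul1n _, erefl _)
    ((row_mx 1%:M 0 : 'M[R]_(1, 1 + 1)) *t (1%:M : 'M[R]_(N * d))).

Definition VS f W (mu alpha : R) (xinf : 'cV[R]_(N * d))
    (xi : 'cV[R]_(2 * (N * d))) : R :=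
  qform (Smat mu alpha) xi
  + Fpen f W alpha (Tmat *m xi + xinf) - Fpen f W alpha xinf.

Definition xi_init (x0 xm1 xinf : 'cV[R]_(N * d)) : 'cV[R]_(2 * (N * d)) :=
  stack (fun j : 'I_2 => if j == 0 then x0 - xinf else xm1 - xinf).

Definition C1 f (fmin : 'I_N -> R) (mu L : R) : R :=
  Num.sqrt (2 * L * \sum_i (f i 0 - fmin i)) * (1 + 2 * (L + mu) / mu).

End Objectives.

Section Probability.
Context {R : realType} {dT : measure_display} {T : measurableType dT}.
Variable P : probability T R.

Definition borel_cV (n : nat) := g_sigma_algebraType (@open 'cV[R]_n).

Definition sigma_gen d' (U : measurableType d') (Y : T -> U) : set (set T) :=
  preimage_set_system setT Y measurable.

(* [Z] is a version of the conditional expectation E[X | G]. *)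
Definition is_cond_exp (G : set (set T)) (X Z : T -> R) : Prop :=
  [/\ P.-integrable setT (EFin \o X),
      P.-integrable setT (EFin \o Z),
      forall B : set R, measurable B -> G (Z @^-1` B) &
      forall A, G A ->
        (\int[P]_(w in A) (Z w)%:E = \int[P]_(w in A) (X w)%:E)%E].

Definition is_cond_exp_vec n (G : set (set T)) (X Z : T -> 'cV[R]_n) : Prop :=
  forall j, is_cond_exp G (fun w => X w j 0) (fun w => Z w j 0).

(* E[X | G] <= c almost surely. *)
Definition cond_exp_le (G : set (set T)) (X : T -> R) (c : R) : Prop :=
  exists2 Z, is_cond_exp G X Z & {ae P, forall w, Z w <= c}.

Definition independent_systems (F G : set (set T)) : Prop :=
  forall A B, F A -> G B -> (P (A `&` B) = P A * P B)%E.

End Probability.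

Section Algorithm.
Context {R : realType} {dT : measure_display} {T : measurableType dT}.
Variable P : probability T R.
Context {N d : nat} {dX : measure_display} {Xi : 'I_N -> measurableType dX}.

Definition independent_noise (w : forall i : 'I_N, nat -> {RV P >-> Xi i}) :
    Prop :=
  forall (i : 'I_N) (k : nat),
    independent_systems P (sigma_gen (w i k))
      <<s [set A | exists (j : 'I_N) (t : nat),
             ((t < k)%N \/ t = k /\ j != i) /\ sigma_gen (w j t) A] >>.

(* Each node's oracle is jointly Borel measurable, which is what makes its
   outputs random vectors. *)
Definition measurable_oracle (g : forall i : 'I_N, 'cV[R]_d -> Xi i -> 'cV[R]_d) :
    Prop :=
  forall i, measurable_fun setT
    (fun p : borel_cV (R := R) d * Xi i => g i p.1 p.2 : borel_cV (R := R) d).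

Definition stoch_grad (g : forall i : 'I_N, 'cV[R]_d -> Xi i -> 'cV[R]_d)
    (w : forall i : 'I_N, nat -> {RV P >-> Xi i}) (k : nat) (om : T)
    (y : 'cV[R]_(N * d)) : 'cV[R]_(N * d) :=
  stack (fun i => g i (block y i) (w i k om)).

Definition noise_moments (f : 'I_N -> 'cV[R]_d -> R) (sigma : R)
    (g : forall i : 'I_N, 'cV[R]_d -> Xi i -> 'cV[R]_d)
    (w : forall i : 'I_N, nat -> {RV P >-> Xi i})
    (y : nat -> T -> 'cV[R]_(N * d)) : Prop :=
  forall (i : 'I_N) (k : nat),
    let yik om := block (y k om) i in
    let G := sigma_gen (yik : T -> borel_cV (R := R) d) in
    is_cond_exp_vec P G (fun om => g i (yik om) (w i k om))
                        (fun om => grad (f i) (yik om)) /\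
    cond_exp_le P G
      (fun om => enorm (g i (yik om) (w i k om) - grad (f i) (yik om)) ^+ 2)
      (sigma ^+ 2).

(* [xm1] is the iterate of index -1. *)
Definition dasg_iterates (W : 'M[R]_N) (alpha beta : R)
    (g : forall i : 'I_N, 'cV[R]_d -> Xi i -> 'cV[R]_d)
    (w : forall i : 'I_N, nat -> {RV P >-> Xi i})
    (x0 xm1 : 'cV[R]_(N * d)) (x y : nat -> T -> 'cV[R]_(N * d)) : Prop :=
  [/\ forall om, x 0%N om = x0,
      forall k om, y k om = (1 + beta) *: x k om
        - beta *: (if k is k'.+1 then x k' om else xm1) &
      forall k om, x k.+1 om =
        bigW W *m y k om - alpha *: stoch_grad g w k om (y k om)].

End Algorithm.

(* Main.v *)
From HB Require Import structures.
Require Import Defs.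
From mathcomp Require Import ring lra measurable_realfun.
From mathcomp Require Import spectral.
From mathcomp.real_closed Require Import complex.
Set Implicit Arguments.
Unset Strict Implicit.
Unset Printing Implicit Defensive.
Local Open Scope classical_set_scope.
Local Open Scope ring_scope.

(* Write q = sqrt (alpha mu), Phi for the penalized objective and
   La = (1 - lambda_N) / alpha + L for its smoothness constant.  Without noise an
   iteration is an accelerated gradient step for Phi with step alpha <= 1 / La, and
   V = |x_k - xinf - (1 - q) (x_(k-1) - xinf)|^2 / (2 alpha) + Phi x_k - Phi xinf
   contracts by 1 - q.  An additive noise e changes V by at most
   <h, e> + alpha / 2 (1 + alpha La) |e|^2 with h depending on the past only, so the
   recursion is unrolled pathwise and expectations are taken once, at the end.

   E <h, e> = 0: the oracle is centered given y_i alone, whereas h depends on the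
   whole history; independence of the fresh sample from the history makes their
   joint law a product, and Fubini reduces the claim to the conditional mean
   being zero.

   Bias: |grad F xinf|^2 <= 2 L sum_i (f_i 0 - f_i^* ).  Since
   (I - W) xinf = - alpha grad F xinf, the spectral gap bounds the disagreement r of
   xinf by alpha |grad F xinf| / (1 - gamma), and strong convexity bounds the distance
   of its average to x_* by (L / mu) |r|. *)

(** * Euclidean inner product and block vectors *)

Section InnerProduct.
Context {R : realType}.

Definition dot n (x y : 'cV[R]_n) : R := \sum_i x i 0 * y i 0.

Lemma dotC n (x y : 'cV[R]_n) : dot x y = dot y x.
Proof. by apply: eq_bigr => i _; rewrite mulrC. Qed.

Lemma dotDl n (x y z : 'cV[R]_n) : dot (x + y) z = dot x z + dot y z.
Proof. by rewrite -big_split; apply: eq_bigr => i _; rewrite mxE mulrDl. Qed.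

Lemma dotZl n a (x z : 'cV[R]_n) : dot (a *: x) z = a * dot x z.
Proof. by rewrite mulr_sumr; apply: eq_bigr => i _; rewrite mxE mulrA. Qed.

Lemma dotNl n (x z : 'cV[R]_n) : dot (- x) z = - dot x z.
Proof. by rewrite -scaleN1r dotZl mulN1r. Qed.

Lemma dotDr n (x y z : 'cV[R]_n) : dot z (x + y) = dot z x + dot z y.
Proof. by rewrite dotC dotDl !(dotC z). Qed.

Lemma dotZr n a (x z : 'cV[R]_n) : dot z (a *: x) = a * dot z x.
Proof. by rewrite dotC dotZl dotC. Qed.

Lemma dotNr n (x z : 'cV[R]_n) : dot z (- x) = - dot z x.
Proof. by rewrite dotC dotNl dotC. Qed.

Definition dotE := (dotDl, dotDr, dotZl, dotZr, dotNl, dotNr).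

Lemma sqnormE n (x : 'cV[R]_n) : sqnorm x = dot x x.
Proof. by apply: eq_bigr => i _; rewrite expr2. Qed.

Lemma sqnorm_ge0 n (x : 'cV[R]_n) : 0 <= sqnorm x.
Proof. by apply: sumr_ge0 => i _; rewrite sqr_ge0. Qed.

Lemma sqnorm_eq0 n (x : 'cV[R]_n) : sqnorm x = 0 -> x = 0.
Proof.
move=> /eqP; rewrite psumr_eq0 => [/allP h|i _]; last exact: sqr_ge0.
by apply/colP => i; apply/eqP; rewrite mxE -sqrf_eq0; apply: h; rewrite mem_index_enum.
Qed.

Lemma enorm_sqr n (x : 'cV[R]_n) : enorm x ^+ 2 = sqnorm x.
Proof. by rewrite sqr_sqrtr ?sqnorm_ge0. Qed.

Lemma enorm_ge0 n (x : 'cV[R]_n) : 0 <= enorm x.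
Proof. exact: sqrtr_ge0. Qed.

Lemma sqr_coord_le n (x : 'cV[R]_n) i : x i 0 ^+ 2 <= sqnorm x.
Proof.
rewrite /sqnorm (bigD1 i)//= lerDl; apply: sumr_ge0 => j _; exact: sqr_ge0.
Qed.

Lemma sqnormZ n a (x : 'cV[R]_n) : sqnorm (a *: x) = a ^+ 2 * sqnorm x.
Proof. by rewrite !sqnormE !dotE; ring. Qed.

Lemma sqnormN n (x : 'cV[R]_n) : sqnorm (- x) = sqnorm x.
Proof. by rewrite !sqnormE !dotE; ring. Qed.

Lemma sqnormD_le n (x y : 'cV[R]_n) :
  sqnorm (x + y) <= 2 * sqnorm x + 2 * sqnorm y.
Proof.
have := sqnorm_ge0 (x - y); rewrite !sqnormE !dotE (dotC y x) => h; lra.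
Qed.

(** Expanding [|a - c b|^2 >= 0] gives [2 c <a, b> <= |a|^2 + c^2 |b|^2 <= 2 c^2 |b|^2]. Dividing by
    [c] forces the separate case [c = 0], where [a] vanishes. *)
Lemma dot_le_lipschitz n c (a b : 'cV[R]_n) : 0 <= c ->
  sqnorm a <= c ^+ 2 * sqnorm b -> dot a b <= c * sqnorm b.
Proof.
rewrite le_eqVlt => /predU1P[<-|c0].
  rewrite expr0n !mul0r => a0.
  have/sqnorm_eq0 -> : sqnorm a = 0 by apply/eqP; rewrite eq_le a0 sqnorm_ge0.
  by rewrite -[X in dot X](scale0r b) dotZl mul0r.
have := sqnorm_ge0 (a - c *: b); rewrite !sqnormE !dotE (dotC b a) => h1 h2.
rewrite -(ler_pM2l c0); lra.
Qed.

(** Expanding [|a - m u|^2 >= 0] turns a coercivity estimate into a lower bound on a norm. The bias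
    estimate uses it twice. *)
Lemma sqnorm_le_coercive n m (a u : 'cV[R]_n) :
  0 <= m -> m * sqnorm u <= dot a u -> m ^+ 2 * sqnorm u <= sqnorm a.
Proof.
move=> m0 h; have := sqnorm_ge0 (a - m *: u).
have := ler_wpM2l m0 h.
rewrite !sqnormE !dotE (dotC u a) => h1 h2; lra.
Qed.

Lemma dot_mulmxl n p (A : 'M[R]_(n, p)) x y : dot (A *m x) y = dot x (A^T *m y).
Proof.
have E k (u v : 'cV[R]_k) : dot u v = (u^T *m v) 0 0.
  by rewrite mxE; apply: eq_bigr => i _; rewrite mxE.
by rewrite !E trmx_mul mulmxA.
Qed.

Lemma qformE n (A : 'M[R]_n) x : qform A x = dot (A *m x) x.
Proof.
by rewrite dotC /qform -mulmxA !mxE; apply: eq_bigr => i _; rewrite mxE.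
Qed.

End InnerProduct.

Section Blocks.
Context {R : realType} {N d : nat}.

Lemma sum_mxtens (F : 'I_(N * d) -> R) :
  \sum_k F k = \sum_i \sum_j F (mxtens_index (i, j)).
Proof.
rewrite pair_big (reindex (fun p : 'I_N * 'I_d => mxtens_index p)).
  by apply: eq_bigr => -[].
by exists (@mxtens_unindex N d) => i _; rewrite ?mxtens_indexK ?mxtens_unindexK.
Qed.

Lemma block_stack (u : 'I_N -> 'cV[R]_d) i : block (stack u) i = u i.
Proof. by apply/colP => j; rewrite !mxE mxtens_indexK. Qed.

Lemma blockD (x y : 'cV[R]_(N * d)) i : block (x + y) i = block x i + block y i.
Proof. by apply/colP => j; rewrite !mxE. Qed.

Lemma blockN (x : 'cV[R]_(N * d)) i : block (- x) i = - block x i.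
Proof. by apply/colP => j; rewrite !mxE. Qed.

Lemma dot_block (x y : 'cV[R]_(N * d)) :
  dot x y = \sum_i dot (block x i) (block y i).
Proof.
by rewrite /dot sum_mxtens; do 2!apply: eq_bigr => ? _; rewrite !mxE.
Qed.

Lemma sqnorm_block (x : 'cV[R]_(N * d)) : sqnorm x = \sum_i sqnorm (block x i).
Proof. by rewrite sqnormE dot_block; apply: eq_bigr => i _; rewrite sqnormE. Qed.

(** The j-th coordinates of all nodes, as opposed to [block], which collects all coordinates of one
    node. [W] tensored with the identity acts on each slice as [W], so bounds on the quadratic form
    of [W] carry over to [bigW W]. *)
Definition slice (x : 'cV[R]_(N * d)) (j : 'I_d) : 'cV[R]_N :=
  \col_i x (mxtens_index (i, j)) 0.

Lemma dot_slice (x y : 'cV[R]_(N * d)) :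
  dot x y = \sum_j dot (slice x j) (slice y j).
Proof.
rewrite /dot sum_mxtens exchange_big.
by do 2!apply: eq_bigr => ? _; rewrite !mxE.
Qed.

Lemma sqnorm_slice (x : 'cV[R]_(N * d)) : sqnorm x = \sum_j sqnorm (slice x j).
Proof. by rewrite sqnormE dot_slice; apply: eq_bigr => i _; rewrite sqnormE. Qed.

Lemma slice_bigW (W : 'M[R]_N) (x : 'cV[R]_(N * d)) j :
  slice (bigW W *m x) j = W *m slice x j.
Proof.
apply/colP => i; rewrite !mxE sum_mxtens; apply: eq_bigr => k _.
rewrite (bigD1 j)//= big1 => [|l lj]; rewrite ?tensmxE !mxE ?eqxx.
  by rewrite mulr1 addr0.
by rewrite eq_sym (negPf lj) mulr0 mul0r.
Qed.

Lemma qform_bigW (W : 'M[R]_N) (x : 'cV[R]_(N * d)) :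
  qform (bigW W) x = \sum_j qform W (slice x j).
Proof.
by rewrite qformE dot_slice; apply: eq_bigr => j _; rewrite slice_bigW qformE.
Qed.

Lemma trmx_bigW (W : 'M[R]_N) : (bigW W : 'M[R]_(N * d))^T = bigW W^T.
Proof. by rewrite /bigW trmx_tens trmx1. Qed.

Lemma qformB n (A B : 'M[R]_n) x : qform (A - B) x = qform A x - qform B x.
Proof. by rewrite !qformE mulmxBl !dotE. Qed.

Lemma qform1 n (x : 'cV[R]_n) : qform 1%:M x = sqnorm x.
Proof. by rewrite qformE mul1mx sqnormE. Qed.

End Blocks.

(** * Smooth strongly convex functions *)

Section SmoothFunctions.
Context {R : realType} {n : nat}.
Implicit Types (f : 'cV[R]_n -> R) (x y u : 'cV[R]_n).

Lemma cV_sum_delta u : u = \sum_i u i 0 *: delta_mx i 0.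
Proof.
apply/colP => j; rewrite summxE (bigD1 j)//= big1 => [|i ij]; rewrite !mxE ?eqxx.
  by rewrite mulr1 addr0.
by rewrite eq_sym (negPf ij) mulr0.
Qed.

Lemma derive_grad f x u : differentiable f x -> 'D_u f x = dot (grad f x) u.
Proof.
move=> df; rewrite deriveE// {1}(cV_sum_delta u) linear_sum.
by apply: eq_bigr => i _; rewrite linearZ/= mxE -deriveE// mulrC.
Qed.

Lemma is_derive_line f y u (t : R) : differentiable f (y + t *: u) ->
  is_derive t 1 (fun s : R => f (y + s *: u)) (dot (grad f (y + t *: u)) u).
Proof.
move=> df; rewrite -derive_grad//.
have E : (fun h : R => h^-1 *:
    (((fun s : R => f (y + s *: u)) \o shift t) (h *: 1) - f (y + t *: u))) =
  (fun h : R => h^-1 *: ((f \o shift (y + t *: u)) (h *: u) - f (y + t *: u))).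
  apply/funext => h /=; congr (_ *: (f _ - _)).
  by rewrite [h *: 1]mulr1 scalerDl addrCA.
split; last by rewrite /derive E.
by rewrite /derivable E; exact: diff_derivable.
Qed.

(** The sign [e] treats the upper and the lower Taylor bound at once. With the quadratic [t ^+ 2]
    subtracted, the function along the segment has nonpositive derivative by the Lipschitz
    condition, and the mean value theorem compares its endpoints. *)
Lemma lipschitz_gradient_taylor L f y u (e : R) : 0 <= L -> e ^+ 2 = 1 ->
  lipschitz_gradient L f ->
  e * (f (y + u) - f y - dot (grad f y) u) <= L / 2 * sqnorm u.
Proof.
move=> L0 e1 [df lf].
pose g (t : R) := e * (f (y + t *: u) - t * dot (grad f y) u)
   - (L / 2 * sqnorm u) * t ^+ 2.
pose dg t := e * (dot (grad f (y + t *: u)) u - dot (grad f y) u)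
   - (L * sqnorm u) * t.
have dgP (t : R) : is_derive t 1 g (dg t).
  have := is_derive_line (df (y + t *: u)) => h.
  rewrite /g.
  apply: is_derive_eq.
  rewrite /dg /GRing.scale/=; lra.
have gc : {within `[0, 1], continuous g}.
  apply: continuous_subspaceT => t.
  apply: differentiable_continuous; apply/derivable1_diffP.
  exact: (@ex_derive _ _ _ _ _ _ _ (dgP t)).
have [c /itvP c01] := MVT ltr01 (fun t _ => dgP t) gc.
rewrite subr0 mulr1 => gE.
suff : dg c <= 0.
  rewrite -gE /g scale0r addr0 scale1r expr0n expr1n /= => h; lra.
rewrite /dg -mulrA (mulrC (sqnorm _)) mulrA subr_le0.
rewrite -dotNl -dotDl -dotZl; apply: dot_le_lipschitz.
  by rewrite mulr_ge0// c01.
rewrite sqnormZ e1 mul1r exprMn -mulrA -sqnormZ -!enorm_sqr -exprMn.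
rewrite lerXn2r ?nnegrE ?mulr_ge0 ?enorm_ge0//.
by have := lf (y + c *: u) y; rewrite addrAC subrr add0r.
Qed.

Lemma lipschitz_gradient_upper L f y z : 0 <= L -> lipschitz_gradient L f ->
  f z <= f y + dot (grad f y) (z - y) + L / 2 * sqnorm (z - y).
Proof.
move=> L0 /(lipschitz_gradient_taylor y (z - y) L0 (expr1n _ 2)).
rewrite subrKC; lra.
Qed.

(** Strong convexity at [y + t u], combined with the lower Taylor bound there and divided by [t],
    bounds the violation [gap] by a multiple of [t]; then [t] is taken small. *)
Lemma strongly_convex_lower mu L f y z : 0 <= L -> lipschitz_gradient L f ->
  strongly_convex mu f ->
  f y + dot (grad f y) (z - y) + mu / 2 * sqnorm (z - y) <= f z.
Proof.
move=> L0 lf cf; set u := z - y.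
pose gap := f y + dot (grad f y) u + mu / 2 * sqnorm u - f z.
have s0 := sqnorm_ge0 u.
have h t : 0 < t <= 1 -> gap <= t * ((L + mu) / 2 * sqnorm u).
  move=> /andP[t0 t1].
  have := cf z y t; rewrite (ltW t0) t1 => /(_ isT).
  have -> : t *: z + (1 - t) *: y = y + t *: u.
    by rewrite /u scalerBr scalerBl scale1r addrC -addrA (addrC (- _)).
  rewrite enorm_sqr -/u => h1.
  have e1 : (-1 : R) ^+ 2 = 1 by rewrite sqrrN expr1n.
  have := lipschitz_gradient_taylor y (t *: u) L0 e1 lf.
  rewrite sqnormZ dotZr => h2.
  rewrite -(ler_pM2l t0) /gap; lra.
rewrite -subr_le0 -/gap leNgt; apply/negP => gap0.
have [c0|c0] := leP ((L + mu) / 2 * sqnorm u) 0.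
  by have := h 1; rewrite ltr01 lexx => /(_ isT); rewrite mul1r; lra.
set c := (L + mu) / 2 * sqnorm u in h c0.
(* This [t] replaces the limit: [t * c <= gap / 2], which contradicts [gap <= t * c] for a positive
   gap. *)
have t0 : 0 < Num.min 1 (gap / (2 * c)).
  by rewrite lt_min ltr01 divr_gt0// mulr_gt0.
have := h (Num.min 1 (gap / (2 * c))); rewrite t0 ge_min lexx => /(_ isT).
apply/negP; rewrite -ltNge; apply: (@le_lt_trans _ _ (gap / (2 * c) * c)).
  by rewrite ler_pM2r// ge_min lexx orbT.
have -> : gap / (2 * c) * c = gap / 2 by field; rewrite gt_eqF.
lra.
Qed.

End SmoothFunctions.

(** * One accelerated gradient step *)

Section AcceleratedStep.
Context {R : realType} {n : nat}.
Variables (Phi : 'cV[R]_n -> R) (G : 'cV[R]_n -> 'cV[R]_n) (mu M alpha q : R).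
Variable xinf : 'cV[R]_n.

Hypothesis lower : forall y z,
  Phi y + dot (G y) (z - y) + mu / 2 * sqnorm (z - y) <= Phi z.
Hypothesis upper : forall y z,
  Phi z <= Phi y + dot (G y) (z - y) + M / 2 * sqnorm (z - y).
Hypotheses (alpha0 : 0 < alpha) (alphaM : alpha * M <= 1).
Hypotheses (q0 : 0 <= q) (q1 : q <= 1) (q2 : q ^+ 2 = alpha * mu).

Definition lyap (x xp : 'cV[R]_n) : R :=
  (2 * alpha)^-1 * sqnorm ((x - xinf) - (1 - q) *: (xp - xinf))
  + (Phi x - Phi xinf).

Definition extrapolate (x xp : 'cV[R]_n) : 'cV[R]_n :=
  (1 + (1 - q) / (1 + q)) *: x - ((1 - q) / (1 + q)) *: xp.

Definition grad_step (y : 'cV[R]_n) : 'cV[R]_n := y - alpha *: G y.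

(** The coefficient of [e] in the expansion of [lyap] at the noisy point [z - alpha *: e]: the first
    term is the cross term of the square, the second comes from the smoothness bound of [Phi] at
    [z]. *)
Definition noise_dual (x xp : 'cV[R]_n) : 'cV[R]_n :=
  let z := grad_step (extrapolate x xp) in
  - ((z - xinf) - (1 - q) *: (x - xinf)) - alpha *: G z.

Lemma lyap_step (x xp e : 'cV[R]_n) :
  lyap (grad_step (extrapolate x xp) - alpha *: e) x <=
    (1 - q) * lyap x xp + dot (noise_dual x xp) e
    + alpha / 2 * (1 + alpha * M) * sqnorm e.
Proof.
rewrite /noise_dual; set y := extrapolate x xp; set z := grad_step y.
set x' := z - alpha *: e.
pose a := x - xinf; pose yt := y - xinf.
have q1_neq0 : 1 + q != 0 by rewrite gt_eqF// ltr_pwDl.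
(* By the choice of the momentum coefficient, the square in [lyap x xp] depends on [xp] only through
   the extrapolated point, so [xp] disappears from the computation. *)
have Eb : (x - xinf) - (1 - q) *: (xp - xinf) = (1 + q) *: yt - a.
  by apply/colP => i; rewrite /a /yt /y /extrapolate !mxE; field.
have zE : z = y - alpha *: G y by [].
have Ex' : (x' - xinf) - (1 - q) *: (x - xinf) =
    yt - (1 - q) *: a - alpha *: G y - alpha *: e.
  by apply/colP => i; rewrite /x' zE /yt /a !mxE; ring.
have Ez : (z - xinf) - (1 - q) *: (x - xinf) =
    yt - (1 - q) *: a - alpha *: G y.
  by apply/colP => i; rewrite zE /yt /a !mxE; ring.
have a20 : 0 < 2 * alpha by rewrite mulr_gt0.
(* Descent of the noiseless step; this is where [alpha * M <= 1] enters. *)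
have hA : 2 * alpha * Phi z <= 2 * alpha * Phi y - alpha ^+ 2 * dot (G y) (G y).
  have := upper y z.
  have -> : z - y = - (alpha *: G y) by rewrite zE addrAC subrr add0r.
  rewrite !sqnormE !dotE => /(ler_wpM2l (ltW a20)) h.
  have := sqnorm_ge0 (G y); rewrite sqnormE => g0.
  have : alpha * M * (alpha ^+ 2 * dot (G y) (G y)) <=
      1 * (alpha ^+ 2 * dot (G y) (G y)).
    apply: ler_wpM2r; last exact: alphaM. exact: (mulr_ge0 (sqr_ge0 _) g0).
  lra.
have hB : 2 * alpha * Phi y <= 2 * alpha * Phi x + 2 * alpha * dot (G y) (yt - a)
    - q ^+ 2 * sqnorm (yt - a).
  have := lower y x; have -> : x - y = - (yt - a).
    by apply/colP => i; rewrite /yt /a !mxE; ring.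
  rewrite q2 !sqnormE dotNr dotNl dotNr => /(ler_wpM2l (ltW a20)); lra.
have hC : 2 * alpha * Phi y <= 2 * alpha * Phi xinf + 2 * alpha * dot (G y) yt
    - q ^+ 2 * sqnorm yt.
  have := lower y xinf; have -> : xinf - y = - yt.
    by apply/colP => i; rewrite /yt !mxE; ring.
  rewrite q2 !sqnormE dotNr dotNl dotNr => /(ler_wpM2l (ltW a20)); lra.
have hD : 2 * alpha * Phi x' <= 2 * alpha * Phi z
    - 2 * alpha * (alpha * dot (G z) e) + alpha ^+ 2 * (alpha * M) * sqnorm e.
  have := upper z x'.
  have -> : x' - z = - (alpha *: e) by rewrite /x' addrAC subrr add0r.
  rewrite !sqnormE !dotE => /(ler_wpM2l (ltW a20)); lra.
(* What is left of the quadratic forms once hA-hD are combined. *)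
have hE : 0 <= q * (1 - q) * (1 + q) * sqnorm (yt - a).
  by rewrite !mulr_ge0 ?sqnorm_ge0// ?subr_ge0// addr_ge0.
rewrite /lyap Eb Ex' Ez -(ler_pM2l a20).
rewrite [leLHS]mulrDr [X in _ <= 2 * alpha * (X + _ + _)]mulrDr !(mulrDr (2 * alpha)).
rewrite (mulrCA (2 * alpha) (1 - q)) !mulVKf ?gt_eqF//.
have q1' : 0 <= 1 - q by rewrite subr_ge0.
(* The lower models at [x] and at [xinf] are averaged with weights [1 - q] and [q], which produces
   the contraction factor. *)
have := ler_wpM2l q1' hB; have := ler_wpM2l q0 hC.
move: hA hD hE {hB hC}.
move: zE Eb Ex' Ez; clearbody y z x' a yt => _ _ _ _.
rewrite !sqnormE !dotE (dotC a yt) (dotC (G y) yt) (dotC e yt) (dotC (G y) a).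
rewrite (dotC e a) (dotC e (G y)) => *; lra.
Qed.

(** By the upper model, a step of length [M^-1] along [- G xinf] would decrease [Phi] by at least
    [|G xinf|^2 / (2 M)]. *)
Lemma minimizer_grad0 : 0 < M -> (forall z, Phi xinf <= Phi z) -> G xinf = 0.
Proof.
move=> M0 hmin; apply: sqnorm_eq0.
have := upper xinf (xinf - M^-1 *: G xinf).
have -> : xinf - M^-1 *: G xinf - xinf = - (M^-1 *: G xinf).
  by rewrite addrAC subrr add0r.
move=> h.
have := le_trans (hmin _) h; rewrite !sqnormE !dotE => {}h.
have : (2 * M)^-1 * dot (G xinf) (G xinf) <= 0.
  have : M / 2 * - (M^-1 * - (M^-1 * dot (G xinf) (G xinf))) =
     (2 * M)^-1 * dot (G xinf) (G xinf) by field; rewrite gt_eqF.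
  have : M^-1 * dot (G xinf) (G xinf) = 2 * ((2 * M)^-1 * dot (G xinf) (G xinf)).
    by field; rewrite gt_eqF.
  move: h; lra.
rewrite pmulr_rle0 ?invr_gt0 ?mulr_gt0// => h0.
by apply/eqP; rewrite eq_le h0 -sqnormE sqnorm_ge0.
Qed.

End AcceleratedStep.

(** * Spectrum of a mixing matrix *)

(** The relation gives [U (X - A) = (X - D) U] over polynomials; taking determinants, the nonzero
    factor [det U] cancels. *)
Lemma char_poly_similar (F : fieldType) n (U A D : 'M[F]_n) :
  U \in unitmx -> U *m A = D *m U -> char_poly A = char_poly D.
Proof.
move=> Uu UA; rewrite /char_poly.
have detU : \det (map_mx polyC U) != 0.
  by rewrite det_map_mx polyC_eq0 -unitfE -unitmxE.
apply: (mulfI detU); rewrite -det_mulmx [RHS]mulrC -det_mulmx; congr (\det _).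
by rewrite mulmxBr mulmxBl -!map_mxM UA scalar_mxC.
Qed.

Section Spectral.
Context {R : realType}.
Local Open Scope complex_scope.
Local Open Scope sesquilinear_scope.

Lemma conj_real_complex (x : R) : (x%:C : R[i])^*%R = x%:C.
Proof. by apply: conj_Creal; rewrite complex_real. Qed.

Definition normsq (z : R[i]) : R := Re z ^+ 2 + Im z ^+ 2.

Lemma normsqE (z : R[i]) : (normsq z)%:C = z^*%R * z.
Proof.
rewrite mulrC -normCK normc_def -rmorphXn/= sqr_sqrtr//.
by rewrite addr_ge0 ?sqr_ge0.
Qed.

Lemma normsq_ge0 z : 0 <= normsq z.
Proof. by rewrite addr_ge0 ?sqr_ge0. Qed.

Local Notation toC := (map_mx (real_complex R)).

(** Over the complex numbers a real symmetric matrix is Hermitian, hence unitarily diagonalizable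
    with real eigenvalues. The factorization of the characteristic polynomial ties them, with
    multiplicity, to the list in [ordered_eigenvalues]. *)
Lemma symmetric_spectral n (A : 'M[R]_n) : A^T = A ->
  exists (U : 'M[R[i]]_n) (t : 'I_n -> R),
    [/\ U \is unitarymx,
        char_poly A = \prod_i ('X - (t i)%:P) &
        toC A = U^t* *m diag_mx (\row_i (t i)%:C) *m U].
Proof.
move=> AT.
have ACh : toC A = (toC A)^t*.
  by apply/matrixP => i j; rewrite !mxE -[in LHS]AT mxE conj_real_complex.
have Ah : toC A \is hermsymmx.
  by apply/is_hermitianmxP; rewrite expr0 scale1r.
have /orthomx_spectralP := hermitian_normalmx Ah.
have := hermitian_spectral_diag_real Ah.
set U := spectralmx _; set D := spectral_diag _ => Dr AE.
exists U, (fun i => Re (D 0 i)).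
have DE : \row_i (Re (D 0 i))%:C = D.
  by apply/rowP => i; rewrite mxE RRe_real//; apply: (mxOverP Dr).
rewrite DE; have Uu : U \in unitmx by exact: spectral_unit.
split; first exact: spectral_unitarymx.
  apply: (map_poly_inj (real_complex R)).
  rewrite map_char_poly (@char_poly_similar _ _ U _ (diag_mx D))//; last first.
    by rewrite AE !mulmxA mulmxV// mul1mx.
  rewrite char_poly_trig ?diag_mx_is_trig// rmorph_prod; apply: eq_bigr => i _.
  rewrite rmorphB/= map_polyX map_polyC/= mxE eqxx mulr1n.
  by move/rowP/(_ i): DE; rewrite mxE => ->.
by rewrite -invmx_unitary ?spectral_unitarymx.
Qed.

Lemma sum_normsq n (U : 'M[R[i]]_n) (t : 'I_n -> R) (x : 'cV[R]_n) :
  (\sum_i t i * normsq ((U *m toC x) i 0))%:C =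
  ((toC x)^t* *m (U^t* *m diag_mx (\row_i (t i)%:C) *m U) *m toC x) 0 0.
Proof.
rewrite -!mulmxA mulmxA -map_mxM -trmx_mul mulmxA mxE rmorph_sum; apply: eq_bigr => i _.
rewrite mul_mx_diag !mxE rmorphM/= normsqE; ring.
Qed.

(** Both forms are read off in the unitary coordinates [U x]; the squared norm is the case where
    every eigenvalue is 1. *)
Lemma spectral_forms n (A : 'M[R]_n) (U : 'M[R[i]]_n) (t : 'I_n -> R) :
  U \is unitarymx -> toC A = U^t* *m diag_mx (\row_i (t i)%:C) *m U ->
  forall x, qform A x = \sum_i t i * normsq ((U *m toC x) i 0) /\
            sqnorm x = \sum_i normsq ((U *m toC x) i 0).
Proof.
move=> Uu AE x.
have xE : (toC x)^t* = toC x^T.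
  by apply/matrixP => i j; rewrite !mxE conj_real_complex.
split; apply: (@complexI R).
  by rewrite sum_normsq -AE xE -!map_mxM mxE.
transitivity (\sum_i 1 * normsq ((U *m toC x) i 0))%:C; last first.
  by congr (_%:C); apply: eq_bigr => i _; rewrite mul1r.
rewrite (@sum_normsq _ _ (fun=> 1)).
have -> : diag_mx (\row_i (1%:C : R[i])) = 1%:M.
  by move=> k; rewrite -diag_const_mx; congr diag_mx; apply/rowP => i; rewrite !mxE.
have /unitarymx_unit Uunit := Uu.
rewrite mulmx1 -invmx_unitary// mulVmx// mulmx1 xE -map_mxM mxE -qform1.
by rewrite /qform mulmx1.
Qed.
End Spectral.

(** * Spectral gap from connectivity of the graph *)

Section MixingGap.
Context {R : realType} {N : nat}.
Variables (E : rel 'I_N) (W : 'M[R]_N).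
Hypotheses (hE : connected_graph E) (hW : mixing_matrix E W).

Lemma mixing_ge0 i j : 0 <= W i j.
Proof.
have [_ _ h d] := hW; have [->|/h[h1 h2]] := eqVneq i j; first exact: ltW.
by have [/h1/ltW|/h2 ->] := boolP (E i j).
Qed.

Lemma mixing_sym i j : W i j = W j i.
Proof. by have [WT _ _ _] := hW; rewrite -[in LHS]WT mxE. Qed.

(** Expanding the square, each of the two pure terms sums to [|x|^2] because rows and, by symmetry,
    columns of [W] sum to 1; the cross term is the quadratic form. *)
Lemma laplacian_form (x : 'cV[R]_N) :
  sqnorm x - qform W x = 2^-1 * \sum_i \sum_j W i j * (x i 0 - x j 0) ^+ 2.
Proof.
have [_ row1 _ _] := hW.
have e1 : \sum_i \sum_j W i j * x i 0 ^+ 2 = sqnorm x.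
  by apply: eq_bigr => i _; rewrite -mulr_suml row1 mul1r.
have e2 : \sum_i \sum_j W i j * x j 0 ^+ 2 = sqnorm x.
  rewrite exchange_big/= -e1; do 2!apply: eq_bigr => ? _.
  by rewrite mixing_sym.
have e3 : \sum_i \sum_j W i j * x j 0 * x i 0 = qform W x.
  by rewrite qformE; apply: eq_bigr => i _; rewrite mxE mulr_suml.
transitivity (2^-1 * (\sum_i \sum_j W i j * x i 0 ^+ 2
   + \sum_i \sum_j W i j * x j 0 ^+ 2
   - 2 * \sum_i \sum_j W i j * x j 0 * x i 0)).
  rewrite e1 e2 e3; lra.
congr (_ * _); rewrite mulr_sumr -sumrN -!big_split/=; apply: eq_bigr => i _.
rewrite mulr_sumr -sumrN -!big_split/=; apply: eq_bigr => j _; ring.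
Qed.

Lemma qform_mixing_le (x : 'cV[R]_N) : qform W x <= sqnorm x.
Proof.
rewrite -subr_ge0 laplacian_form mulr_ge0//; apply: sumr_ge0 => i _.
by apply: sumr_ge0 => j _; rewrite mulr_ge0 ?mixing_ge0 ?sqr_ge0.
Qed.

(** A fixed vector makes the Laplacian form vanish, so [x] agrees at the ends of each edge, and then
    along paths by connectivity. *)
Lemma mixing_fixed_const (x : 'cV[R]_N) :
  W *m x = x -> forall i j, x i 0 = x j 0.
Proof.
move=> Wx.
have s0 : \sum_i \sum_j W i j * (x i 0 - x j 0) ^+ 2 = 0.
  have := laplacian_form x; rewrite qformE Wx sqnormE subrr.
  by move=> /esym/eqP; rewrite mulf_eq0 invr_eq0 pnatr_eq0/= => /eqP.
have t0 i j : 0 <= W i j * (x i 0 - x j 0) ^+ 2.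
  by rewrite mulr_ge0 ?mixing_ge0 ?sqr_ge0.
have edge i j : E i j -> x i 0 = x j 0.
  have [->//|ij Eij] := eqVneq i j.
  have [_ _ h _] := hW; have /h[/(_ Eij) W0 _] := ij.
  move/eqP : s0; rewrite psumr_eq0; last by move=> k _; exact: sumr_ge0.
  move=> /allP/(_ i); rewrite mem_index_enum => /(_ isT)/=.
  rewrite psumr_eq0// => /allP/(_ j); rewrite mem_index_enum => /(_ isT)/=.
  by rewrite mulf_eq0 gt_eqF//= sqrf_eq0 subr_eq0 => /eqP.
move=> i j; have [_ /(_ i j)/connectP[p]] := hE.
elim: p i => [|k p IH] i /= => [_ ->//|/andP[/edge -> kp]]; exact: IH.
Qed.

(** In a unitary eigenbasis both forms are weighted sums. The eigenvalue 1 is simple, since its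
    eigenvectors are constant and two constant rows of a unitary matrix are not orthogonal. Vectors
    of zero sum therefore only see the eigenvalues after the first. *)
Lemma mixing_spectrum (lam : seq R) (hN : (1 < N)%N) :
  ordered_eigenvalues W lam ->
  [/\ lam`_N.-1 <= lam`_1, lam`_1 < 1,
      forall x : 'cV[R]_N, lam`_N.-1 * sqnorm x <= qform W x &
      forall x : 'cV[R]_N, \sum_i x i 0 = 0 -> qform W x <= lam`_1 * sqnorm x].
Proof.
move=> [szlam slam charW].
have [WT row1 _ _] := hW.
have [U [t [Uu charE WE]]] := symmetric_spectral WT.
have forms := spectral_forms Uu WE.

(* The Laplacian argument is real, so each row of [U] is split into real and imaginary parts. Both
   are eigenvectors of [W], as [t i] is real and [W] is real and symmetric. *)
pose re i : 'cV[R]_N := \col_k Re (U i k).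
pose im i : 'cV[R]_N := \col_k Im (U i k).
have UW i k : \sum_l U i l * (W l k)%:C%C = (t i)%:C%C * U i k.
  have /(congr1 (mulmx U)) := WE.
  have /unitarymxP UU := Uu.
  rewrite !mulmxA UU mul1mx => /matrixP/(_ i k).
  rewrite mul_diag_mx !mxE => <-.
  by apply: eq_bigr => l _; rewrite mxE.
have Wre i : W *m re i = t i *: re i.
  apply/colP => k; have /(congr1 (@Re R)) := UW i k.
  rewrite raddf_sum !mxE/=; case: (U i k) => a b /= => h.
  transitivity (t i * a - 0 * b) => //; last by rewrite mul0r subr0.
  rewrite -h; apply: eq_bigr => l _; rewrite mxE mixing_sym.
  by case: (U i l) => c d /=; rewrite mulr0 subr0 mulrC.
have Wim i : W *m im i = t i *: im i.
  apply/colP => k; have /(congr1 (@Im R)) := UW i k.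
  rewrite raddf_sum !mxE/=; case: (U i k) => a b /= => h.
  transitivity (t i * b + 0 * a) => //; last by rewrite mul0r addr0.
  rewrite -h; apply: eq_bigr => l _; rewrite mxE mixing_sym.
  by case: (U i l) => c d /=; rewrite mulr0 add0r mulrC.
have norm1 i : sqnorm (re i) + sqnorm (im i) = 1.
  have /unitarymxP/matrixP/(_ i i) := Uu; rewrite !mxE eqxx/= mulr1n => h.
  apply: (@complexI R); rewrite -[RHS]h /sqnorm -big_split rmorph_sum.
  by apply: eq_bigr => k _; rewrite !mxE mulrC -normsqE.
(* One of the two parts may vanish; adding the two bounds and using [norm1] avoids choosing. *)
have t_le1 i : t i <= 1.
  have := lerD (qform_mixing_le (re i)) (qform_mixing_le (im i)).
  by rewrite !qformE Wre Wim !dotZl -!sqnormE -mulrDr norm1 mulr1.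
have Uconst i : t i = 1 -> forall k l, U i k = U i l.
  move=> ti k l; apply/eqP; rewrite eq_complex; apply/andP; split; apply/eqP.
    have := Wre i; rewrite ti scale1r => /mixing_fixed_const/(_ k l).
    by rewrite !mxE.
  have := Wim i; rewrite ti scale1r => /mixing_fixed_const/(_ k l).
  by rewrite !mxE.
have N1 : (0 < N.-1)%N by rewrite -ltnS prednK ?(ltnW hN).
pose k0 : 'I_N := Ordinal (ltnW hN).
have N0 : (0 : R) < N%:R by rewrite ltr0n ltnW.
(* For the all-ones vector the nonnegative terms [(1 - t i) * c i] sum to zero. If no [t i] were 1,
   every coefficient [c i] would vanish, and so would the vector. *)
have [i0 ti0] : exists i, t i = 1.
  pose one : 'cV[R]_N := const_mx 1.
  have Wone : W *m one = one.
    apply/colP => i; rewrite !mxE -[RHS](row1 i).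
    by apply: eq_bigr => j _; rewrite mxE mulr1.
  have [] := forms one; rewrite qformE Wone -sqnormE.
  set c := fun i => normsq ((U *m map_mx (real_complex R) one) i 0) => h1 h2.
  have c0 i : 0 <= (1 - t i) * c i by rewrite mulr_ge0 ?subr_ge0 ?normsq_ge0.
  have : \sum_i (1 - t i) * c i = 0.
    rewrite (eq_bigr (fun i => c i - t i * c i)) => [|i _]; last by ring.
    by rewrite sumrB -h1 -h2 subrr.
  move=> /eqP; rewrite psumr_eq0// => /allP h3.
  have : sqnorm one != 0.
    rewrite gt_eqF// /sqnorm (eq_bigr (fun=> 1)) => [|i _]; last first.
      by rewrite mxE expr1n.
    by rewrite sumr_const card_ord.
  have [/existsP[i /eqP ti] _|/existsPn h4] := boolP [exists i, t i == 1].
    by exists i.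
  rewrite h2 big1 ?eqxx// => i _; have := h3 i; rewrite mem_index_enum => /(_ isT).
  by rewrite mulf_eq0 subr_eq0 eq_sym (negPf (h4 i)) => /eqP.
(* The inner product of two constant rows is [N] times a product of two nonzero entries, against
   orthogonality. *)
have uniq1 i : t i = 1 -> i = i0.
  move=> ti; apply/eqP; apply/negPn/negP => ii0.
  have Ui0 j : t j = 1 -> U j k0 != 0.
    move=> tj; apply/negP => /eqP Uj0.
    have := norm1 j; rewrite /sqnorm !big1 ?addr0 => [/esym/eqP|k _|k _].
    - by rewrite oner_eq0.
    - by rewrite mxE (Uconst _ tj k k0) Uj0 expr0n.
    - by rewrite mxE (Uconst _ tj k k0) Uj0 expr0n.
  have /unitarymxP/matrixP/(_ i i0) := Uu; rewrite !mxE (negPf ii0).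
  rewrite (eq_bigr (fun=> U i k0 * (U i0 k0)^*%R)) => [|k _]; last first.
    by rewrite !mxE (Uconst _ ti k k0) (Uconst _ ti0 k k0).
  rewrite sumr_const card_ord => /eqP; rewrite mulrn_eq0 mulf_eq0 conjC_eq0.
  by rewrite (negPf (Ui0 _ ti)) (negPf (Ui0 _ ti0)) !orbF (gtn_eqF (ltnW hN)).
have perm_lam : perm_eq lam [seq t i | i <- enum 'I_N].
  apply: prod_XsubC_eq; rewrite -charW charE big_map enumT.
  by rewrite /index_enum.
have memlam a : (a \in lam) = (a \in [seq t i | i <- enum 'I_N]).
  exact: perm_mem.
have lam_anti i j : (i <= j)%N -> (j < N)%N -> lam`_j <= lam`_i.
  move=> ij jN; have jlam : (j < size lam)%N by rewrite szlam.
  have := @sorted_leq_nth _ >=%R _ _ 0 _ slam i j.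
  apply => //; [by move=> a b c ab bc; exact: le_trans bc ab|exact: lexx|].
  by rewrite inE szlam (leq_ltn_trans ij).
have lam0 : lam`_0 = 1.
  apply/eqP; rewrite eq_le; apply/andP; split.
    have : lam`_0 \in lam by rewrite mem_nth// szlam ltnW.
    by rewrite memlam => /mapP[i _ ->].
  have : 1 \in lam by rewrite memlam -ti0 map_f// mem_enum.
  by move=> /(nthP 0)[j jN <-]; apply: lam_anti => //; rewrite -szlam.
(* An empty list is excluded because its head would be the default value 0. *)
have [lam' lamE] : exists lam', lam = 1 :: lam'.
  by case: (lam) lam0 => [/eqP|a s /= ->]; [rewrite eq_sym oner_eq0|exists s].
have perm_lam' : perm_eq lam' [seq t i | i <- rem i0 (enum 'I_N)].
  rewrite -(perm_cons 1) -lamE; apply: (perm_trans perm_lam).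
  by rewrite -ti0 -map_cons; apply: perm_map; apply: perm_to_rem; rewrite mem_enum.
have memrem i : (i \in rem i0 (enum 'I_N)) = (i != i0).
  by rewrite mem_rem_uniq ?enum_uniq// !inE mem_enum andbT.
have szlam' : size lam' = N.-1 by rewrite -szlam lamE.
have lam1_in : lam`_1 \in lam'.
  by rewrite lamE/= mem_nth// szlam'.
have Npred : (N.-1 < N)%N by rewrite ltn_predL (ltnW hN).
split.
- exact: lam_anti.
- move: lam1_in; rewrite (perm_mem perm_lam') => /mapP[i + ->].
  rewrite memrem lt_neqAle t_le1 andbT; apply: contra => /eqP ti.
  exact/eqP/uniq1.
- move=> x; have [-> ->] := forms x; rewrite mulr_sumr; apply: ler_sum => i _.
  apply: ler_wpM2r; first exact: normsq_ge0.
  have : t i \in lam by rewrite memlam map_f// mem_enum.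
  move=> /(nthP 0)[j jN <-]; apply: lam_anti => //.
  by rewrite -ltnS prednK ?(ltnW hN)// -szlam.
- move=> x x0; have [-> ->] := forms x; rewrite mulr_sumr; apply: ler_sum => i _.
  (* The row [i0] is constant, so the coordinate of [x] along it is a multiple of the sum of its
     entries, which is zero. *)
  have [->|ii0] := eqVneq i i0.
    suff -> : normsq ((U *m map_mx (real_complex R) x) i0 0) = 0 by rewrite !mulr0.
    rewrite mxE (eq_bigr (fun k => U i0 k0 * (x k 0)%:C%C)) => [|k _]; last first.
      by rewrite mxE (Uconst _ ti0 k k0).
    by rewrite -mulr_sumr -rmorph_sum x0 mulr0 /normsq/= !expr0n addr0.
  apply: ler_wpM2r; first exact: normsq_ge0.
  have : t i \in lam' by rewrite (perm_mem perm_lam') map_f// memrem.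
  move=> /(nthP 0)[j jN <-].
  have := @lam_anti 1 j.+1; rewrite lamE/=; apply => //.
  by rewrite szlam' in jN; rewrite -[N]prednK ?ltnS// ltnW.
Qed.

End MixingGap.

(** * Independence and Fubini *)

Section IndependentFubini.
Context {R : realType} {dT : measure_display} {T : measurableType dT}.
Variable P : probability T R.
Context {dS dU : measure_display} {S : measurableType dS} {U : measurableType dU}.
Variables (H : {mfun T >-> S}) (w : {mfun T >-> U}).
Hypothesis ind : forall A B, measurable A -> measurable B ->
  (P (H @^-1` A `&` w @^-1` B) = P (H @^-1` A) * P (w @^-1` B))%E.
Local Open Scope ereal_scope.

Let J (om : T) : S * U := (H om, w om).

Let mJ : measurable_fun [set: T] J.
Proof. exact: measurable_fun_pair. Qed.

HB.instance Definition _ := isMeasurableFun.Build _ _ _ _ J mJ.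

(** Independence says that the two measures agree on rectangles, and this determines a product
    measure. *)
Lemma indep_joint_law (A : set (S * U)) : measurable A ->
  (distribution P H \x distribution P w) A = distribution P J A.
Proof.
by apply: product_measure_unique => B C mB mC; rewrite -ind.
Qed.

Lemma indep_integrable (X : S * U -> \bar R) :
  measurable_fun setT X ->
  P.-integrable [set: T] (fun om => X (H om, w om)) ->
  (distribution P H \x distribution P w).-integrable setT X.
Proof.
move=> mX iX; have /integrableP[_ fin] : (distribution P J).-integrable setT X.
  exact: integrable_pushforward.
apply/integrableP; split=> //.
rewrite (eq_measure_integral (distribution P J)) => [//|A mA _].
exact: indep_joint_law.
Qed.

Lemma indep_fubini (X : S * U -> \bar R) :
  measurable_fun setT X ->
  P.-integrable [set: T] (fun om => X (H om, w om)) ->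
  \int[P]_om X (H om, w om) =
  \int[distribution P H]_s \int[distribution P w]_u X (s, u).
Proof.
move=> mX iX; rewrite [RHS]integral12_prod_meas1; last exact: indep_integrable.
rewrite (eq_measure_integral (distribution P J)) => [|A mA _].
  by rewrite (integral_pushforward mJ).
exact: indep_joint_law.
Qed.

End IndependentFubini.

(** * Orthogonality of conditionally centered noise to the past *)

Section ConditionallyCentered.
Context {R : realType} {dT : measure_display} {T : measurableType dT}.
Variable P : probability T R.
Context {dS dU dV : measure_display} {S : measurableType dS}
  {U : measurableType dU} {V : measurableType dV}.
Variables (H : {mfun T >-> S}) (w : {mfun T >-> U}).
Hypothesis ind : forall A B, measurable A -> measurable B ->
  (P (H @^-1` A `&` w @^-1` B) = P (H @^-1` A) * P (w @^-1` B))%E.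
Local Open Scope ereal_scope.

(** Here [H] is the full history, [y] the part of it given which [phi] is centered, and [psi v] the
    mean of [phi (v, w)] for frozen [v]. Centering makes [psi] integrate to zero over every event of
    [y], so it vanishes almost everywhere. By Fubini over [(H, w)] the inner integral is
    [h s * psi (y s)], hence zero. *)
Lemma indep_centered_orthogonal (y : S -> V) (h : S -> R) (phi : V * U -> R) :
  measurable_fun setT y -> measurable_fun setT h -> measurable_fun setT phi ->
  P.-integrable setT (fun om => (phi (y (H om), w om))%:E) ->
  (forall B, measurable B ->
    \int[P]_(om in (y \o H) @^-1` B) (phi (y (H om), w om))%:E = 0) ->
  P.-integrable setT (fun om => (h (H om) * phi (y (H om), w om))%:E) ->
  \int[P]_om (h (H om) * phi (y (H om), w om))%:E = 0.
Proof.
move=> my mh mphi iphi phi0 ihphi.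
pose Y := y \o H.
have mY : measurable_fun setT Y by exact: measurableT_comp.
pose HY : {mfun T >-> V} := HB.pack Y (isMeasurableFun.Build _ _ _ _ Y mY).
have indY A B : measurable A -> measurable B ->
    P (HY @^-1` A `&` w @^-1` B) = P (HY @^-1` A) * P (w @^-1` B).
  move=> mA mB; have := @ind (y @^-1` A) B _ mB; apply.
  by rewrite -[X in measurable X]setTI; exact: my.
pose psi v := \int[distribution P w]_u (phi (v, u))%:E.
have mphiE : measurable_fun setT (EFin \o phi) by exact/measurable_EFinP.
have iphi2 := indep_integrable indY mphiE iphi.
have ipsi : (distribution P HY).-integrable setT psi.
  exact: (integrable_fubini_F iphi2).
have psi0 : ae_eq (distribution P HY) setT psi (cst 0).
  apply: integral_ae_eq => // B _ mB; rewrite integral0 integral_mkcond.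
  rewrite -(phi0 B mB) [RHS]integral_mkcond.
  have mYB : measurable (Y @^-1` B).
    by rewrite -[X in measurable X]setTI; exact: (mY measurableT).
  (* Restriction to an event of [Y] is written as an indicator factor, so that the integral falls
     under [indep_fubini]. *)
  pose X (p : V * U) := (\1_B p.1 * phi p)%:E.
  have mX : measurable_fun setT X.
    apply/measurable_EFinP; apply: measurable_funM => //.
    exact: measurableT_comp.
  have XE om : X (Y om, w om) = ((fun om => (phi (y (H om), w om))%:E) \_ (Y @^-1` B)) om.
    rewrite /X patchE/= indicE.
    have -> : (om \in Y @^-1` B) = (Y om \in B) by [].
    by case: (Y om \in B); rewrite ?mul1r ?mul0r.
  have -> : (fun om => (phi (y (H om), w om))%:E) \_ ((y \o H) @^-1` B) =
      fun om => X (Y om, w om) by apply/funext => om; rewrite XE.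
  rewrite (indep_fubini indY mX); last first.
    under eq_fun do rewrite XE.
    apply/(integrable_mkcond _ _).1 => //.
    by apply: integrableS iphi.
  apply: eq_integral => v _; rewrite patchE /X/= indicE.
  case: (v \in B); first by apply: eq_integral => u _; rewrite mul1r.
  by rewrite integral0_eq// => u _; rewrite mul0r.
pose X (p : S * U) := (h p.1 * phi (y p.1, p.2))%:E.
have mphiy : measurable_fun setT (fun p : S * U => phi (y p.1, p.2)).
  apply: (measurableT_comp mphi); apply: measurable_fun_pair => //.
  exact: measurableT_comp.
have mX : measurable_fun setT X.
  apply/measurable_EFinP; apply: measurable_funM => //.
  exact: measurableT_comp.
have iphi3 : (distribution P H \x distribution P w).-integrable setT
    (fun p => (phi (y p.1, p.2))%:E).
  by apply: indep_integrable => //; exact/measurable_EFinP.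
rewrite (indep_fubini ind mX)//.
rewrite (ae_eq_integral (cst 0))//; first by rewrite integral0.
  exact: (measurable_fubini_F (indep_integrable ind mX ihphi)).
(* The exceptional set for the law of [y (H)] is pulled back along [y] to a null set for the law of
   [H]. *)
have aepsi : {ae distribution P H, forall s, psi (y s) = 0}.
  have [Z [mZ Z0 sub]] := psi0.
  exists (y @^-1` Z); split => //.
    by rewrite -[X in measurable X]setTI; exact: my.
  by move=> s /= hs; apply: sub => /= hv; apply: hs; exact: hv.
move: aepsi; apply: filterS2 (ae_integrable1 iphi3) => s i1 i2 _ /=.
rewrite /X/= -[RHS](mule0 (h s)%:E) -i2 -integralZl//.
Qed.

End ConditionallyCentered.

(** * Square-integrable random vectors *)

(** Lipschitz continuity with an unspecified constant, squared to avoid roots. It serves to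
    transport measurability and square integrability through the gradient maps, where the value of
    the constant is immaterial. *)
Definition sq_lipschitz {R : realType} n p (phi : 'cV[R]_n -> 'cV[R]_p) : Prop :=
  exists2 C, 0 <= C & forall x y, sqnorm (phi x - phi y) <= C * sqnorm (x - y).

(** * Borel and coordinatewise measurability *)

Section BorelVectors.
Context {R : realType}.

Lemma continuous_borel_cV n (f : 'cV[R]_n -> R) :
  continuous f -> measurable_fun setT (f : borel_cV n -> R).
Proof.
move=> cf; apply: (measurability _ (RGenOpens.measurableE R)).
move=> _ [_ [a [b ->]] <-]; rewrite setTI; apply: sub_sigma_algebra.
by apply: open_comp => [x _|]; [exact: cf|exact: interval_open].
Qed.

Lemma sq_lipschitz_continuous n p (phi : 'cV[R]_n -> 'cV[R]_p) i :
  sq_lipschitz phi -> continuous (fun x => phi x i 0).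
Proof.
move=> [C C0 hC] x; apply/(cvgrPdist_lt (FF := nbhs_filter x)) => eps eps0.
(* The ambient norm is the sup norm, so a ball of radius [e] has [sqnorm] at most [n * e ^+ 2]. The
   summand 1 keeps the denominator positive and makes [s * e < eps]. *)
pose s := Num.sqrt (C * n%:R); pose e := eps / (s + 1).
have s0 : 0 < s + 1 by rewrite ltr_wpDl ?sqrtr_ge0.
have e0 : 0 < e by rewrite divr_gt0.
apply/nbhs_ballP; exists e => //= y [_ xy].
rewrite -(@ltr_pXn2r _ 2)// ?nnegrE ?(ltW eps0)// -normrX ger0_norm ?sqr_ge0//.
have -> : (phi x i 0 - phi y i 0) ^+ 2 = (phi x - phi y) i 0 ^+ 2 by rewrite !mxE.
apply: (le_lt_trans (sqr_coord_le _ _)); apply: (le_lt_trans (hC _ _)).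
have : sqnorm (x - y) <= n%:R * e ^+ 2.
  rewrite -[n in n%:R]card_ord mulr_natl -sumr_const; apply: ler_sum => j _.
  have := xy j 0; rewrite !mxE /ball/= => h.
  by rewrite -[X in X <= _]ger0_norm ?sqr_ge0// normrX lerXn2r ?nnegrE// ltW.
move=> /(ler_wpM2l C0) h; apply: (le_lt_trans h).
have sE : s ^+ 2 = C * n%:R by rewrite sqr_sqrtr// mulr_ge0.
have -> : C * (n%:R * e ^+ 2) = (s * e) ^+ 2 by rewrite [RHS]exprMn sE mulrA.
have se0 : 0 <= s * e by rewrite mulr_ge0 ?sqrtr_ge0// ltW.
rewrite (@ltr_pXn2r _ 2)// ?nnegrE ?(ltW eps0)//.
by rewrite /e mulrCA gtr_pMr// ltr_pdivrMr// mul1r ltrDl ltr01.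
Qed.

Lemma id_sq_lipschitz n : sq_lipschitz (@id 'cV[R]_n).
Proof. by exists 1 => // x y; rewrite mul1r. Qed.

Lemma measurable_cV_coord n i :
  measurable_fun setT (fun x : borel_cV (R := R) n => (x : 'cV[R]_n) i 0).
Proof.
exact: (continuous_borel_cV (sq_lipschitz_continuous (@id_sq_lipschitz n))).
Qed.

(** Measurability by coordinates, relative to an arbitrary sigma-algebra on the source: over a
    history sigma-algebra it expresses adaptedness. *)
Definition vmeas d (S : measurableType d) n (X : S -> 'cV[R]_n) : Prop :=
  forall i, measurable_fun setT (fun s => X s i 0).

(* An open set is the union of the countably many boxes with rational center
   and inverse integer radius that it contains. *)
Lemma vmeas_borel d (S : measurableType d) n (X : S -> 'cV[R]_n) :
  vmeas X -> measurable_fun setT (X : S -> borel_cV n).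
Proof.
move=> mX; apply: (@measurability _ _ S (borel_cV n) setT X (@open 'cV[R]_n) erefl).
move=> _ [A oA <-]; rewrite setTI.
pose box (p : 'cV[rat]_n * nat) : set 'cV[R]_n :=
  [set x | forall i, `|x i 0 - ratr (p.1 i 0)| < p.2.+1%:R^-1].
pose F (p : 'cV[rat]_n * nat) : set S :=
  if `[< box p `<=` A >] then X @^-1` box p else set0.
have -> : X @^-1` A = \bigcup_p F p.
  apply/seteqP; split => [s As|s [p _]]; last first.
    by rewrite /F; case: ifPn => // /asboolP; exact.
  have /nbhs_ballP[e /= e0 eA] : nbhs (X s) A by move: oA; rewrite openE; exact.
  (* Two points of a box of radius [1 / (m + 1)] are less than [2 / (m + 1)] apart, so a box around
     [X s] stays in the ball of radius [e]. *)
  have [m hm] : exists m : nat, 2 * m.+1%:R^-1 < e.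
    exists (Num.truncn (2 / e)).
    by rewrite ltr_pdivrMr// mulrC -ltr_pdivrMr// truncnS_gt.
  have m0 : (0 : R) < m.+1%:R^-1 by rewrite invr_gt0.
  have hq (i : 'I_n) : exists r : rat, `|X s i 0 - ratr r| < m.+1%:R^-1.
    have : X s i 0 - m.+1%:R^-1 < X s i 0 + m.+1%:R^-1.
      by rewrite ltrBlDr -addrA ltrDl addr_gt0.
    move=> /rat_in_itvoo[r]; rewrite in_itv/= => hr; exists r.
    by rewrite ltr_distlC.
  have /choice[q qP] := hq.
  have sbox : box (\col_i q i, m) (X s) by move=> i; rewrite mxE; exact: qP.
  exists (\col_i q i, m) => //; rewrite /F; case: ifPn => // /asboolPn[].
  move=> y ybox; apply: eA; split => // i j; rewrite ord1.
  have h1 := sbox i; have h2 := ybox i; rewrite /= !mxE in h1 h2.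
  rewrite /ball/=; apply: (le_lt_trans (ler_distD (ratr (q i)) _ _)).
  rewrite (distrC (ratr _)); apply: lt_trans hm.
  by rewrite mulr_natl mulr2n; exact: ltrD.
apply: countable_bigcupT_measurable => [|p]; first exact: countableP.
rewrite /F; case: ifP => // _.
have -> : X @^-1` box p =
    \bigcap_(i in [set: 'I_n]) ((fun s => X s i 0) @^-1`
      `]ratr (p.1 i 0) - p.2.+1%:R^-1, ratr (p.1 i 0) + p.2.+1%:R^-1[%classic).
  apply/seteqP; split => s /= h i.
    by move=> _; have := h i; rewrite /= in_itv/= -ltr_distl.
  by have := h i Logic.I; rewrite /= in_itv/= -ltr_distl.
apply: fin_bigcap_measurable => // i _; rewrite -[X in measurable X]setTI.
exact: (mX i measurableT).
Qed.

End BorelVectors.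

Section MeasurableVectors.
Context {R : realType} {dS : measure_display} {S : measurableType dS}.

Lemma vmeas_cst n (v : 'cV[R]_n) : vmeas (fun _ : S => v).
Proof. by move=> i; exact: measurable_cst. Qed.

Lemma vmeasD n (X Y : S -> 'cV[R]_n) :
  vmeas X -> vmeas Y -> vmeas (fun s => X s + Y s).
Proof.
move=> mX mY i; under eq_fun do rewrite mxE; exact: measurable_funD.
Qed.

Lemma vmeasZ n a (X : S -> 'cV[R]_n) : vmeas X -> vmeas (fun s => a *: X s).
Proof.
move=> mX i; under eq_fun do rewrite mxE.
by apply: measurable_funM => //; exact: measurable_cst.
Qed.

Lemma vmeasB n (X Y : S -> 'cV[R]_n) :
  vmeas X -> vmeas Y -> vmeas (fun s => X s - Y s).
Proof.
move=> mX mY; under eq_fun do rewrite -(scaleN1r (Y _)).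
exact/vmeasD/vmeasZ.
Qed.

Lemma vmeas_lip n p (phi : 'cV[R]_n -> 'cV[R]_p) (X : S -> 'cV[R]_n) :
  sq_lipschitz phi -> vmeas X -> vmeas (fun s => phi (X s)).
Proof.
move=> lphi mX i.
exact: (measurableT_comp
  (continuous_borel_cV (sq_lipschitz_continuous (i := i) lphi)) (vmeas_borel mX)).
Qed.

Lemma vmeas_block N d (X : S -> 'cV[R]_(N * d)) i :
  vmeas X -> vmeas (fun s => block (X s) i).
Proof. by move=> mX j; under eq_fun do rewrite mxE; exact: mX. Qed.

Lemma vmeas_stack N d (u : 'I_N -> S -> 'cV[R]_d) :
  (forall i, vmeas (u i)) -> vmeas (fun s => stack (fun i => u i s)).
Proof. by move=> mu k; under eq_fun do rewrite mxE; exact: mu. Qed.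

Lemma measurable_dot n (X Y : S -> 'cV[R]_n) :
  vmeas X -> vmeas Y -> measurable_fun setT (fun s => dot (X s) (Y s)).
Proof.
by move=> mX mY; apply: measurable_sum => i; exact: measurable_funM.
Qed.

Lemma measurable_sqnorm n (X : S -> 'cV[R]_n) :
  vmeas X -> measurable_fun setT (fun s => sqnorm (X s)).
Proof.
by move=> mX; under eq_fun do rewrite sqnormE; exact: measurable_dot.
Qed.

End MeasurableVectors.

Section SquareIntegrable.
Context {R : realType} {dT : measure_display} {T : measurableType dT}.
Variable P : probability T R.

Definition vL2 n (X : T -> 'cV[R]_n) : Prop :=
  vmeas X /\ P.-integrable setT (fun om => (sqnorm (X om))%:E).

Lemma integrable_dominated (f h : T -> R) : measurable_fun setT f ->
  (forall om, `|f om| <= h om) -> P.-integrable setT (EFin \o h) ->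
  P.-integrable setT (EFin \o f).
Proof.
move=> mf fh; apply: le_integrable => //; first exact/measurable_EFinP.
by move=> om _ /=; rewrite lee_fin (le_trans (fh om)) ?ler_norm.
Qed.

Lemma integrable_lin (f h : T -> R) (a b : R) :
  P.-integrable setT (EFin \o f) -> P.-integrable setT (EFin \o h) ->
  P.-integrable setT (EFin \o (fun om => a * f om + b * h om)).
Proof.
move=> fi hi; have := integrableD measurableT
  (integrableZl measurableT a fi) (integrableZl measurableT b hi).
exact.
Qed.

Lemma vL2_cst n (v : 'cV[R]_n) : vL2 (fun _ => v).
Proof.
split; first exact: vmeas_cst.
exact: finite_measure_integrable_cst.
Qed.

(** The common source of the closure properties below: sums, multiples and Lipschitz images are each
    dominated by two square-integrable vectors. *)
Lemma vL2_dominated n p q (X : T -> 'cV[R]_n) (Y : T -> 'cV[R]_p)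
    (Z : T -> 'cV[R]_q) (a b : R) : vmeas X ->
  (forall om, sqnorm (X om) <= a * sqnorm (Y om) + b * sqnorm (Z om)) ->
  vL2 Y -> vL2 Z -> vL2 X.
Proof.
move=> mX h [mY iY] [mZ iZ]; split => //.
apply: (integrable_dominated _ _ (integrable_lin a b iY iZ)).
  exact: measurable_sqnorm.
by move=> om; rewrite ger0_norm ?sqnorm_ge0.
Qed.

Lemma vL2D n (X Y : T -> 'cV[R]_n) :
  vL2 X -> vL2 Y -> vL2 (fun om => X om + Y om).
Proof.
move=> hX hY; apply: (@vL2_dominated _ _ _ _ _ _ 2 2 _ _ hX hY) => [|om].
  exact: vmeasD hX.1 hY.1.
exact: sqnormD_le.
Qed.

Lemma vL2Z n a (X : T -> 'cV[R]_n) : vL2 X -> vL2 (fun om => a *: X om).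
Proof.
move=> hX; apply: (@vL2_dominated _ _ _ _ _ _ (a ^+ 2) 0 _ _ hX hX) => [|om].
  exact: vmeasZ hX.1.
by rewrite mul0r addr0 sqnormZ.
Qed.

Lemma vL2B n (X Y : T -> 'cV[R]_n) :
  vL2 X -> vL2 Y -> vL2 (fun om => X om - Y om).
Proof.
move=> mX mY; under eq_fun do rewrite -(scaleN1r (Y _)).
exact/vL2D/vL2Z.
Qed.

Lemma vL2_lip n p (phi : 'cV[R]_n -> 'cV[R]_p) (X : T -> 'cV[R]_n) :
  sq_lipschitz phi -> vL2 X -> vL2 (fun om => phi (X om)).
Proof.
move=> lphi hX; have [C C0 hC] := lphi.
apply: (@vL2_dominated _ _ _ _ _ _ (2 * C) 2 _ _ hX (vL2_cst (phi 0))) => [|om].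
  exact: vmeas_lip lphi hX.1.
have := sqnormD_le (phi (X om) - phi 0) (phi 0); rewrite subrK.
have := hC (X om) 0; rewrite subr0; lra.
Qed.

Lemma dot_abs_le n (u v : 'cV[R]_n) : `|dot u v| <= 1 * sqnorm u + 1 * sqnorm v.
Proof.
have := sqnorm_ge0 (u - v); have := sqnorm_ge0 (u + v).
have := sqnorm_ge0 u; have := sqnorm_ge0 v.
rewrite ler_norml !sqnormE !dotE (dotC v u) => ? ? ? ?; apply/andP; split; lra.
Qed.

Lemma vL2_dot_integrable n (X Y : T -> 'cV[R]_n) : vL2 X -> vL2 Y ->
  P.-integrable setT (EFin \o (fun om => dot (X om) (Y om))).
Proof.
move=> [mX iX] [mY iY].
apply: (integrable_dominated _ _ (integrable_lin 1 1 iX iY)).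
  exact: measurable_dot.
by move=> om; exact: dot_abs_le.
Qed.

Lemma vL2_coordM_integrable n (X Y : T -> 'cV[R]_n) i : vL2 X -> vL2 Y ->
  P.-integrable setT (EFin \o (fun om => X om i 0 * Y om i 0)).
Proof.
move=> [mX iX] [mY iY].
apply: (integrable_dominated _ _ (integrable_lin 1 1 iX iY)).
  exact: measurable_funM.
move=> om; rewrite normrM !mul1r.
have := sqr_coord_le (X om) i; have := sqr_coord_le (Y om) i.
rewrite -![_ i 0 ^+ 2]real_normK ?num_real//.
set a := `|X om i 0|; set b := `|Y om i 0|.
have := sqr_ge0 (a - b); have := sqr_ge0 (a + b); rewrite !expr2; lra.
Qed.

Lemma vL2_stack N d (u : 'I_N -> T -> 'cV[R]_d) :
  (forall i, vL2 (u i)) -> vL2 (fun om => stack (fun i => u i om)).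
Proof.
move=> hu; split; first by apply: vmeas_stack => i; exact: (hu i).1.
under eq_fun do (rewrite sqnorm_block -sumEFin; under eq_bigr do rewrite block_stack).
by apply: integrable_sum => // i _; exact: (hu i).2.
Qed.

End SquareIntegrable.

(** * The penalized objective *)

Section LipschitzMaps.
Context {R : realType}.

(** Expand the squared norm of [|b|^2 a - <a, b> b] and divide by [|b|^2]; the case [b = 0] is
    separate. *)
Lemma cauchy_schwarz n (a b : 'cV[R]_n) : dot a b ^+ 2 <= sqnorm a * sqnorm b.
Proof.
have : 0 <= sqnorm b by exact: sqnorm_ge0.
rewrite le_eqVlt => /predU1P[/esym b0|b0].
  by rewrite b0 (sqnorm_eq0 b0) -(scale0r b) dotZr mul0r expr0n mulr0.
rewrite -(ler_pM2l b0).
have := sqnorm_ge0 (sqnorm b *: a - dot a b *: b).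
rewrite [in X in X -> _]sqnormE !dotE (dotC b a) -!sqnormE; lra.
Qed.

Lemma sq_lipschitzD n p (u v : 'cV[R]_n -> 'cV[R]_p) :
  sq_lipschitz u -> sq_lipschitz v -> sq_lipschitz (fun x => u x + v x).
Proof.
move=> [C C0 hC] [D D0 hD]; exists (2 * C + 2 * D) => [|x y].
  by rewrite addr_ge0 ?mulr_ge0.
rewrite opprD addrACA; have := sqnormD_le (u x - u y) (v x - v y).
have := hC x y; have := hD x y; lra.
Qed.

Lemma sq_lipschitzZ n p a (u : 'cV[R]_n -> 'cV[R]_p) :
  sq_lipschitz u -> sq_lipschitz (fun x => a *: u x).
Proof.
move=> [C C0 hC]; exists (a ^+ 2 * C) => [|x y]; first by rewrite mulr_ge0 ?sqr_ge0.
by rewrite -scalerBr sqnormZ -[leRHS]mulrA; apply: ler_wpM2l; rewrite ?sqr_ge0.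
Qed.

Lemma sq_lipschitz_mulmx n p (A : 'M[R]_(p, n)) :
  sq_lipschitz (fun x : 'cV[R]_n => A *m x).
Proof.
exists (\sum_i sqnorm (row i A)^T) => [|x y].
  by apply: sumr_ge0 => i _; exact: sqnorm_ge0.
rewrite -mulmxBr mulr_suml; apply: ler_sum => i _.
apply: le_trans (cauchy_schwarz _ _); rewrite [in leLHS]mxE.
suff -> : dot (row i A)^T (x - y) = \sum_j A i j * (x - y) j 0 by [].
by apply: eq_bigr => j _; rewrite !mxE.
Qed.

End LipschitzMaps.

Section Objective.
Context {R : realType} {N d : nat}.
Variables (mu L : R) (f : 'I_N -> 'cV[R]_d -> R).
Hypotheses (L0 : 0 < L).
Hypothesis hf_sc : forall i, strongly_convex mu (f i).
Hypothesis hf_sm : forall i, lipschitz_gradient L (f i).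

Definition grad_Fsum (x : 'cV[R]_(N * d)) : 'cV[R]_(N * d) :=
  stack (fun i => grad (f i) (block x i)).

Lemma Fsum_lower y z :
  Fsum f y + dot (grad_Fsum y) (z - y) + mu / 2 * sqnorm (z - y) <= Fsum f z.
Proof.
rewrite dot_block sqnorm_block mulr_sumr -!big_split/=; apply: ler_sum => i _.
rewrite block_stack blockD blockN.
exact: (strongly_convex_lower _ _ (ltW L0) (hf_sm i)).
Qed.

Lemma Fsum_upper y z :
  Fsum f z <= Fsum f y + dot (grad_Fsum y) (z - y) + L / 2 * sqnorm (z - y).
Proof.
rewrite dot_block sqnorm_block mulr_sumr -!big_split/=; apply: ler_sum => i _.
rewrite block_stack blockD blockN.
exact: (lipschitz_gradient_upper _ _ (ltW L0) (hf_sm i)).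
Qed.

Lemma grad_sq_lipschitz i x y :
  sqnorm (grad (f i) x - grad (f i) y) <= L ^+ 2 * sqnorm (x - y).
Proof.
rewrite -!enorm_sqr -exprMn lerXn2r ?nnegrE ?enorm_ge0//.
  by rewrite mulr_ge0 ?enorm_ge0// ltW.
exact: (hf_sm i).2.
Qed.

Lemma grad_Fsum_lipschitz x y : sqnorm (grad_Fsum x - grad_Fsum y) <= L ^+ 2 * sqnorm (x - y).
Proof.
rewrite !sqnorm_block mulr_sumr; apply: ler_sum => i _.
by rewrite !(blockD, blockN) !block_stack grad_sq_lipschitz.
Qed.

(** In each block, the point [u - L^-1 *: grad (f i) u] has value at least [fmin i] and, by
    smoothness, at most [f i u - |grad (f i) u|^2 / (2 L)]. *)
Lemma sqnorm_grad_Fsum_le (fmin : 'I_N -> R) x :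
  (forall i, is_min_value (f i) (fmin i)) ->
  sqnorm (grad_Fsum x) <= 2 * L * (Fsum f x - \sum_i fmin i).
Proof.
move=> hmin; rewrite /Fsum -sumrB mulr_sumr sqnorm_block; apply: ler_sum => i _.
rewrite block_stack; set u := block x i.
have := lipschitz_gradient_upper u (u - L^-1 *: grad (f i) u) (ltW L0) (hf_sm i).
have -> : u - L^-1 *: grad (f i) u - u = - (L^-1 *: grad (f i) u).
  by rewrite addrAC subrr add0r.
move=> h; have := le_trans ((hmin i).2 _) h.
rewrite dotNr dotZr sqnormN sqnormZ -sqnormE => {}h.
have e : L / 2 * (L^-1 ^+ 2 * sqnorm (grad (f i) u)) =
    L^-1 * sqnorm (grad (f i) u) / 2 by field; rewrite gt_eqF.
have L20 : 0 <= 2 * L by rewrite mulr_ge0// ltW.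
have := ler_wpM2l L20 h; rewrite e.
have -> : 2 * L * (f i u - L^-1 * sqnorm (grad (f i) u)
    + L^-1 * sqnorm (grad (f i) u) / 2) =
    2 * L * f i u - sqnorm (grad (f i) u) by field; rewrite gt_eqF.
lra.
Qed.

Variables (W : 'M[R]_N) (alpha lN : R).
Hypotheses (alpha0 : 0 < alpha) (WT : W^T = W).
Hypothesis W_le1 : forall x : 'cV[R]_N, qform W x <= sqnorm x.
Hypothesis W_ge : forall x : 'cV[R]_N, lN * sqnorm x <= qform W x.

Definition grad_Fpen (x : 'cV[R]_(N * d)) : 'cV[R]_(N * d) :=
  alpha^-1 *: (x - bigW W *m x) + grad_Fsum x.

Lemma qform_bigW_le (x : 'cV[R]_(N * d)) : qform (bigW W) x <= sqnorm x.
Proof. by rewrite qform_bigW sqnorm_slice; exact: ler_sum. Qed.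

Lemma qform_bigW_ge (x : 'cV[R]_(N * d)) : lN * sqnorm x <= qform (bigW W) x.
Proof. by rewrite qform_bigW sqnorm_slice mulr_sumr; exact: ler_sum. Qed.

(** The quadratic penalty equals its second-order expansion, symmetry of [W] merging the cross
    terms. Upper and lower models then follow from bounds on [W] and those of [Fsum]. *)
Lemma Fpen_expand y z : Fpen f W alpha z =
  Fpen f W alpha y + alpha^-1 * dot (y - bigW W *m y) (z - y)
  + (2 * alpha)^-1 * (sqnorm (z - y) - qform (bigW W) (z - y))
  + (Fsum f z - Fsum f y).
Proof.
rewrite /Fpen !qformB !qform1 !qformE.
have -> : alpha^-1 = (2 * alpha)^-1 * 2 by field; rewrite gt_eqF.
have E : dot (bigW W *m y) z = dot (bigW W *m z) y.
  by rewrite dot_mulmxl trmx_bigW WT dotC.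
rewrite !mulmxDr !mulmxN !sqnormE !dotE E (dotC z y) (dotC (bigW W *m z) y).
ring.
Qed.

Lemma Fpen_lower y z : Fpen f W alpha y + dot (grad_Fpen y) (z - y)
  + mu / 2 * sqnorm (z - y) <= Fpen f W alpha z.
Proof.
rewrite (Fpen_expand y z) /grad_Fpen (dotDl (alpha^-1 *: _)) dotZl.
have := Fsum_lower y z; have := qform_bigW_le (z - y).
rewrite -subr_ge0 => h; have : 0 <= (2 * alpha)^-1 *
    (sqnorm (z - y) - qform (bigW W) (z - y)).
  by rewrite mulr_ge0// invr_ge0 mulr_ge0// ltW.
lra.
Qed.

Definition Fpen_smoothness : R := alpha^-1 * (1 - lN) + L.

Lemma Fpen_upper y z : Fpen f W alpha z <= Fpen f W alpha y
  + dot (grad_Fpen y) (z - y) + Fpen_smoothness / 2 * sqnorm (z - y).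
Proof.
rewrite (Fpen_expand y z) /grad_Fpen (dotDl (alpha^-1 *: _)) dotZl.
have := Fsum_upper y z.
have h : sqnorm (z - y) - qform (bigW W) (z - y) <= (1 - lN) * sqnorm (z - y).
  have := qform_bigW_ge (z - y); lra.
have a0 : 0 <= (2 * alpha)^-1 by rewrite invr_ge0 mulr_ge0// ltW.
have := ler_wpM2l a0 h.
have -> : (2 * alpha)^-1 = alpha^-1 / 2 by field; rewrite gt_eqF.
rewrite /Fpen_smoothness; lra.
Qed.

(** * Distance from the penalized minimizer to the exact consensus solution *)

Variables (gamma : R) (fmin : 'I_N -> R) (xs : 'cV[R]_d) (xinf : 'cV[R]_(N * d)).
Hypotheses (N0 : (0 < N)%N) (mu0 : 0 < mu) (gamma1 : gamma < 1).
Hypothesis Wrow1 : forall i, \sum_j W i j = 1.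
Hypothesis gap : forall x : 'cV[R]_N,
  \sum_i x i 0 = 0 -> qform W x <= gamma * sqnorm x.
Hypothesis hmin : forall i, is_min_value (f i) (fmin i).
Hypothesis hxs : unique_minimizer (average f) xs.
Hypothesis hxinf : unique_minimizer (Fpen f W alpha) xinf.
Hypothesis Gxinf : grad_Fpen xinf = 0.

Lemma unique_minimizer_le n (h : 'cV[R]_n -> R) x z :
  unique_minimizer h x -> h x <= h z.
Proof. by move=> hx; have [->//|/hx/ltW] := eqVneq z x. Qed.

Lemma sum_grad_minimizer : \sum_i grad (f i) xs = 0.
Proof.
have N0' : (0 : R) < N%:R by rewrite ltr0n.
apply: (@minimizer_grad0 _ _ (fun x => \sum_i f i x)
    (fun x => \sum_i grad (f i) x) (N%:R * L) xs) => [y z||z].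
- rewrite -[N in N%:R]card_ord -mulrA mulr_natl -sumr_const.
  have -> : dot (\sum_i grad (f i) y) (z - y) = \sum_i dot (grad (f i) y) (z - y).
    rewrite /dot exchange_big; apply: eq_bigr => j _.
    by rewrite summxE mulr_suml.
  rewrite mulr_suml -!big_split/=; apply: ler_sum => i _.
  rewrite mulrA; exact: (lipschitz_gradient_upper _ _ (ltW L0) (hf_sm i)).
- exact: mulr_gt0.
- by have := unique_minimizer_le z hxs; rewrite /average ler_pM2l ?invr_gt0.
Qed.

Lemma bigW_consensus (v : 'cV[R]_d) :
  bigW W *m stack (fun=> v) = stack (fun=> v) :> 'cV[R]_(N * d).
Proof.
apply/colP => k; case: (mxtens_indexP k) => i j.
have := slice_bigW W (stack (fun=> v) : 'cV[R]_(N * d)) j.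
move=> /colP/(_ i); rewrite mxE => ->; rewrite !mxE mxtens_indexK/=.
under eq_bigr do rewrite !mxE mxtens_indexK/=.
by rewrite -mulr_suml Wrow1 mul1r.
Qed.

Lemma grad_Fsum_xinf : alpha *: grad_Fsum xinf = - (xinf - bigW W *m xinf).
Proof.
move: Gxinf => /(congr1 (fun u => alpha *: u)).
rewrite /grad_Fpen scalerDr scaler0 scalerA mulfV ?gt_eqF// scale1r => /eqP.
by rewrite addrC addr_eq0 => /eqP.
Qed.

Lemma dot_laplacian_consensus (x : 'cV[R]_(N * d)) v :
  dot (x - bigW W *m x) (stack (fun=> v)) = 0.
Proof.
by rewrite dotDl dotNl dot_mulmxl trmx_bigW WT bigW_consensus subrr.
Qed.

Lemma bias_bound : sqnorm (xinf - stack (fun=> xs)) <=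
  C1 f fmin mu L ^+ 2 * N%:R * alpha ^+ 2 / (1 - gamma) ^+ 2.
Proof.
have N0' : (0 : R) < N%:R by rewrite ltr0n.
pose m := N%:R^-1 *: \sum_i block xinf i.
pose M : 'cV[R]_(N * d) := stack (fun=> m).
pose Z : 'cV[R]_(N * d) := stack (fun=> xs).
(* [r] is the disagreement of the nodes, with slices of zero sum, and [c] is the error of their
   average. *)
pose r := xinf - M; pose c := M - Z.
have cE : c = stack (fun=> m - xs).
  by apply/colP => k; rewrite !mxE.
pose D2 := 2 * L * \sum_i (f i 0 - fmin i).
have G_le : sqnorm (grad_Fsum xinf) <= D2.
  apply: (le_trans (sqnorm_grad_Fsum_le xinf hmin)).
  have L20 : 0 <= 2 * L by rewrite mulr_ge0// ltW.
  rewrite /D2 ler_wpM2l// sumrB lerD2r.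
  (* The penalty vanishes at 0 and is nonnegative at [xinf], so minimality gives
     [Fsum f xinf <= Fsum f 0]. *)
  have := unique_minimizer_le 0 hxinf; rewrite /Fpen.
  have -> : qform (1%:M - bigW W) (0 : 'cV[R]_(N * d)) = 0.
    by rewrite qformE mulmx0 /dot big1// => i _; rewrite mxE mul0r.
  have -> : Fsum f 0 = \sum_i f i 0.
    by apply: eq_bigr => i _; congr (f i _); apply/colP => j; rewrite !mxE.
  rewrite mulr0 add0r; apply: le_trans; rewrite lerDr mulr_ge0//.
    by rewrite invr_ge0 mulr_ge0// ltW.
  by rewrite qformB qform1 subr_ge0 qform_bigW_le.
have D20 : 0 <= D2 by exact: le_trans (sqnorm_ge0 _) G_le.
have r_le : (1 - gamma) ^+ 2 * sqnorm r <= alpha ^+ 2 * D2.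
  apply: (@le_trans _ _ (sqnorm (- (alpha *: grad_Fsum xinf)))).
    apply: sqnorm_le_coercive; first by rewrite subr_ge0 ltW.
    have -> : - (alpha *: grad_Fsum xinf) = r - bigW W *m r.
      rewrite grad_Fsum_xinf opprK /r mulmxDr mulmxN bigW_consensus.
      by apply/colP => k; rewrite !mxE; ring.
    rewrite dotDl dotNl -sqnormE -qformE qform_bigW mulrBl mul1r lerD2l lerN2.
    rewrite sqnorm_slice mulr_sumr; apply: ler_sum => j _; apply: gap.
    transitivity (\sum_i block xinf i j 0 - N%:R * m j 0).
      rewrite -[N in N%:R]card_ord mulr_natl -sumr_const -sumrB.
      by apply: eq_bigr => i _; rewrite !mxE mxtens_indexK.
    by rewrite mxE mulVKf ?gt_eqF// summxE subrr.
  by rewrite sqnormN sqnormZ ler_wpM2l ?sqr_ge0.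
have c_le : mu ^+ 2 * sqnorm c <= L ^+ 2 * sqnorm r.
  apply: (@le_trans _ _ (sqnorm (grad_Fsum M - grad_Fsum xinf))); last first.
    apply: (le_trans (grad_Fsum_lipschitz _ _)).
    by rewrite -[sqnorm r]sqnormN opprB.
  apply: sqnorm_le_coercive; first exact: ltW.
  have h1 := Fsum_lower M Z; have h2 := Fsum_lower Z M.
  have eN : Z - M = - c by rewrite opprB.
  rewrite eN sqnormN dotNr -/c in h1; rewrite -/c in h2.
  (* The direction [c] is a consensus vector. The gradient at [Z] is orthogonal to it by optimality
     of [xs], the one at [xinf] because it is a multiple of [(I - W) xinf]. Adding the strong
     convexity bounds between [M] and [Z] thus gives coercivity of the gradient difference. *)
  have e1 : dot (grad_Fsum Z) c = 0.
    rewrite dot_block cE; under eq_bigr do rewrite !block_stack.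
    transitivity (dot (\sum_i grad (f i) xs) (m - xs)); last first.
      by rewrite sum_grad_minimizer -(scale0r 0) dotZl mul0r.
    rewrite /dot exchange_big; apply: eq_bigr => j _.
    by rewrite summxE mulr_suml.
  have e2 : dot (grad_Fsum xinf) c = 0.
    have := dot_laplacian_consensus xinf (m - xs).
    rewrite -cE -[xinf - _]opprK -grad_Fsum_xinf dotNl dotZl => /eqP.
    by rewrite oppr_eq0 mulf_eq0 gt_eqF//= => /eqP.
  rewrite dotDl dotNl e2; lra.
have -> : xinf - stack (fun=> xs) = r + c.
  by rewrite /r /c addrA subrK.
apply: (le_trans (sqnormD_le _ _)).
have g0 : 0 < (1 - gamma) ^+ 2 by rewrite exprn_gt0// subr_gt0.
rewrite ler_pdivlMr// /C1 exprMn sqr_sqrtr// -/D2.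
have m20 : 0 < mu ^+ 2 by rewrite exprn_gt0.
rewrite -(ler_pM2l m20).
have -> : 1 + 2 * (L + mu) / mu = (3 * mu + 2 * L) / mu by field; rewrite gt_eqF.
have -> : mu ^+ 2 * (D2 * ((3 * mu + 2 * L) / mu) ^+ 2 * N%:R * alpha ^+ 2) =
   (3 * mu + 2 * L) ^+ 2 * (alpha ^+ 2 * D2) * N%:R by field; rewrite gt_eqF.
set A := alpha ^+ 2 * D2 in r_le *.
have A0 : 0 <= A by rewrite mulr_ge0 ?sqr_ge0.
apply: (@le_trans _ _ (2 * (mu ^+ 2 + L ^+ 2) * A)).
  apply: (@le_trans _ _ (2 * (mu ^+ 2 + L ^+ 2) * ((1 - gamma) ^+ 2 * sqnorm r))).
    have := ler_wpM2l (ltW g0) c_le; lra.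
  by rewrite ler_wpM2l// mulr_ge0// addr_ge0 ?sqr_ge0.
(* The stated constant is generous: [2 (mu^2 + L^2) <= (3 mu + 2 L)^2], and the factor [N] is at
   least 1. *)
have N1 : (1 : R) <= N%:R by rewrite ler1n.
apply: (@le_trans _ _ ((3 * mu + 2 * L) ^+ 2 * A * 1)).
  rewrite mulr1 ler_wpM2r//.
  have := mulr_gt0 mu0 L0; have := sqr_ge0 mu; have := sqr_ge0 L.
  rewrite !expr2; lra.
by rewrite ler_wpM2l// mulr_ge0// sqr_ge0.
Qed.

End Objective.

(** * The Lyapunov recursion *)

Section Iterate.
Context {R : realType} {n : nat}.
Variables (Phi : 'cV[R]_n -> R) (G : 'cV[R]_n -> 'cV[R]_n) (mu M alpha q : R).
Variable xinf : 'cV[R]_n.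
Hypothesis lower : forall y z,
  Phi y + dot (G y) (z - y) + mu / 2 * sqnorm (z - y) <= Phi z.
Hypothesis upper : forall y z,
  Phi z <= Phi y + dot (G y) (z - y) + M / 2 * sqnorm (z - y).
Hypotheses (alpha0 : 0 < alpha) (alphaM : alpha * M <= 1).
Hypotheses (q0 : 0 <= q) (q1 : q <= 1) (q2 : q ^+ 2 = alpha * mu).
Variables x xp e : nat -> 'cV[R]_n.
Hypothesis xS : forall k, x k.+1 =
  grad_step G alpha (extrapolate q (x k) (xp k)) - alpha *: e k.
Hypothesis xpS : forall k, xp k.+1 = x k.

Lemma lyap_iter k :
  lyap Phi alpha q xinf (x k) (xp k) <=
  (1 - q) ^+ k * lyap Phi alpha q xinf (x 0%N) (xp 0%N)
  + \sum_(t < k) (1 - q) ^+ (k.-1 - t) *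
     (dot (noise_dual G alpha q xinf (x t) (xp t)) (e t)
      + alpha / 2 * (1 + alpha * M) * sqnorm (e t)).
Proof.
elim: k => [|k IH]; first by rewrite big_ord0 expr0 mul1r addr0.
have q1' : 0 <= 1 - q by rewrite subr_ge0.
rewrite [in leLHS]xS xpS; apply: (le_trans
  (lyap_step xinf lower upper alpha0 alphaM q0 q1 q2 _ _ _)).
rewrite big_ord_recr/= subnn expr0 mul1r -[leLHS]addrA [leRHS]addrA lerD2r.
apply: le_trans (ler_wpM2l q1' IH) _.
rewrite mulrDr exprS mulrA lerD2l mulr_sumr; apply: ler_sum => -[t tk] _ /=.
(* The truncated predecessor is harmless: [t < k] forces [k] to be positive. *)
have -> : (k - t = (k.-1 - t).+1)%N by case: (k) tk => // k' tk; rewrite subSn.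
by rewrite exprS mulrA.
Qed.

Lemma lyap_ge xk xkp : G xinf = 0 ->
  mu / 2 * sqnorm (xk - xinf) <= lyap Phi alpha q xinf xk xkp.
Proof.
move=> G0; have := lower xinf xk; rewrite G0 -(scale0r 0) dotZl mul0r /lyap => h.
have : 0 <= (2 * alpha)^-1 * sqnorm (xk - xinf - (1 - q) *: (xkp - xinf)).
  by rewrite mulr_ge0 ?sqnorm_ge0// invr_ge0 mulr_ge0// ltW.
lra.
Qed.

End Iterate.

(** * The matrix form of the Lyapunov function *)

Section LyapunovMatrix.
Context {R : realType} {N d : nat}.

Lemma Tmat_stack (u : 'I_2 -> 'cV[R]_(N * d)) : Tmat *m stack u = u ord0.
Proof.
have rowE a b : (row_mx 1%:M 0 : 'M[R]_(1, 1 + 1)) a b = (b == ord0)%:R.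
  rewrite mxE; case: splitP => c hc; rewrite (ord1 c) mxE in hc *.
    by rewrite (ord1 a) eqxx -val_eqE/= hc.
  by rewrite -val_eqE/= hc.
have TE k a j : (Tmat : 'M[R]_(N * d, _)) k (mxtens_index (a, j)) =
    ((a == ord0) && (k == j))%:R.
  rewrite castmxE cast_ord_id mxE mxtens_indexK rowE mxE -natrM mulnb.
  by rewrite -[in RHS]val_eqE -[X in _ && X]val_eqE /= modn_small.
apply/colP => k; rewrite mxE sum_mxtens big_ord_recl big_ord_recl big_ord0 addr0.
rewrite [X in _ + X]big1 ?addr0 => [|j _]; last by rewrite TE mul0r.
rewrite (bigD1 k)//= big1 ?addr0 => [|j jk].
  by rewrite TE !eqxx mul1r mxE mxtens_indexK.
by rewrite TE eqxx/= eq_sym (negPf jk) mul0r.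
Qed.

(** With [s = (2 alpha)^(-1/2)] and [q = sqrt (alpha mu)], the vector [vS] is [s] times
    [(1, q - 1)], since [sqrt (mu / 2) = q s]. The rank-one form is thus a single square on each
    slice. *)
Lemma qform_Smat (mu alpha : R) (u : 'I_2 -> 'cV[R]_(N * d)) :
  0 < mu -> 0 < alpha ->
  qform (Smat mu alpha) (stack u) = (2 * alpha)^-1 *
    sqnorm (u ord0 - (1 - Num.sqrt (alpha * mu)) *: u ord_max).
Proof.
move=> mu0 alpha0.
have a20 : 0 < 2 * alpha by exact: mulr_gt0.
(* [Smat] is [bigW] of a 2 by 2 matrix, so the slice decomposition applies with two nodes. *)
rewrite (qform_bigW (vS mu alpha *m (vS mu alpha)^T)) [RHS]mulr_sumr.
apply: eq_bigr => j _.
set z := slice _ j; set v := vS mu alpha.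
have -> : qform (v *m v^T) z = (v^T *m z) 0 0 ^+ 2.
  have -> : qform (v *m v^T) z = ((v^T *m z)^T *m (v^T *m z)) 0 0.
    by rewrite /qform trmx_mul trmxK !mulmxA.
  by rewrite mxE big_ord1 mxE expr2.
rewrite mxE !big_ord_recl big_ord0 addr0 !mxE !mxtens_indexK/=.
pose s := Num.sqrt (2 * alpha)^-1.
have -> : 1 / Num.sqrt (2 * alpha) = s by rewrite div1r -sqrtrV// ltW.
have -> : Num.sqrt (1 / (2 * alpha)) = s by rewrite div1r.
have -> : Num.sqrt (mu / 2) = Num.sqrt (alpha * mu) * s.
  rewrite -sqrtrM ?mulr_ge0 ?ltW//; congr Num.sqrt; field; rewrite gt_eqF//.
have -> : (2 * alpha)^-1 = s ^+ 2 by rewrite sqr_sqrtr// invr_ge0 ltW.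
have -> : lift ord0 ord0 = ord_max :> 'I_2 by apply: val_inj.
ring.
Qed.

Lemma VS_lyap (f : 'I_N -> 'cV[R]_d -> R) W (mu alpha : R)
    (x0 xm1 xinf : 'cV[R]_(N * d)) : 0 < mu -> 0 < alpha ->
  VS f W mu alpha xinf (xi_init x0 xm1 xinf) =
  lyap (Fpen f W alpha) alpha (Num.sqrt (alpha * mu)) xinf x0 xm1.
Proof.
move=> mu0 alpha0; rewrite /VS /xi_init Tmat_stack qform_Smat//= subrK.
by rewrite /lyap -[LHS]addrA.
Qed.

End LyapunovMatrix.

(** * Stochastic gradient noise *)

Section ExpectationBound.
Context {R : realType} {dT : measure_display} {T : measurableType dT}.
Variable P : probability T R.

Lemma expectation_le_sum k (Z : T -> R) (A b : R) (c : 'I_k -> R)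
    (U : 'I_k -> T -> R) : measurable_fun setT Z ->
  (forall t, 0 <= c t) -> (forall om, 0 <= Z om) ->
  (forall t, P.-integrable setT (EFin \o U t)) ->
  (forall t, (\int[P]_om (U t om)%:E <= b%:E)%E) ->
  (forall om, Z om <= A + \sum_t c t * U t om) ->
  ('E_P[Z] <= (A + \sum_t c t * b)%:E)%E.
Proof.
move=> mZ c0 Z0 iU Ub ZU; rewrite unlock.
pose V om := \sum_t c t * U t om.
have VE om : ((V om)%:E = \sum_t (c t)%:E * (U t om)%:E)%E.
  by rewrite /V -sumEFin; apply: eq_bigr => t _; rewrite EFinM.
have icU t : P.-integrable setT (fun om => ((c t)%:E * (U t om)%:E)%E).
  exact: (integrableZl measurableT (c t) (iU t)).
have iV : P.-integrable setT (fun om => (V om)%:E).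
  by under eq_fun do rewrite VE; exact: integrable_sum.
have iA : P.-integrable setT (cst A%:E) by exact: finite_measure_integrable_cst.
apply: (@le_trans _ _ (\int[P]_om (A%:E + (V om)%:E))%E).
  apply: ge0_le_integral => //.
  - by move=> om _; rewrite lee_fin.
  - exact/measurable_EFinP.
  - exact: measurable_int (integrableD measurableT iA iV).
  - by move=> om _; rewrite -EFinD lee_fin.
rewrite (integralD measurableT iA iV) integral_cst//= probability_setT mule1.
rewrite EFinD leeD2l//; under eq_integral do rewrite VE.
rewrite integral_sum// -sumEFin; apply: lee_sum => t _.
rewrite (integralZl measurableT (iU t) (c t)) EFinM.
by apply: lee_wpmul2l; [rewrite lee_fin; exact: c0|exact: Ub].
Qed.

End ExpectationBound.

Section Process.
Context {R : realType} {N d : nat} {dT : measure_display} {T : measurableType dT}.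
Variable P : probability T R.
Context {dX : measure_display} {Xi : 'I_N -> measurableType dX}.
Variables (w : forall i : 'I_N, nat -> {RV P >-> Xi i}).

Definition history (k : nat) : set (set T) :=
  [set A | exists (j : 'I_N) (t : nat), (t < k)%N /\ sigma_gen (w j t) A].

(** The sample space with the sigma-algebra of all noise before step [k], as a measurable type of
    its own. *)
Definition history_space k := g_sigma_algebraType (history k).
HB.instance Definition _ k := Measurable.on (history_space k).

Lemma history_measurable k (A : set T) : <<s history k >> A -> measurable A.
Proof.
apply: smallest_sub; first exact: sigma_algebra_measurable.
by move=> _ [j [t [_ [B mB <-]]]]; exact: measurable_funP.
Qed.

Lemma history_mono k (A : set T) : <<s history k >> A -> <<s history k.+1 >> A.
Proof.
apply: smallest_sub; first exact: smallest_sigma_algebra.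
move=> B [j [t [tk]]] tB; apply: sub_sigma_algebra.
by exists j, t; rewrite ltnS ltnW.
Qed.

Lemma vmeas_history_mono k n (X : T -> 'cV[R]_n) :
  vmeas (X : history_space k -> _) -> vmeas (X : history_space k.+1 -> _).
Proof. by move=> mX i _ B mB; apply: history_mono; exact: (mX i measurableT). Qed.

Lemma vmeas_history k n (X : T -> 'cV[R]_n) : vmeas (X : history_space k -> _) -> vmeas X.
Proof.
by move=> mX i _ B mB; apply: (@history_measurable k); exact: (mX i measurableT).
Qed.

Lemma measurable_noise_history i k : measurable_fun setT (w i k : history_space k.+1 -> Xi i).
Proof. by move=> _ B mB; apply: sub_sigma_algebra; exists i, k; split=> //; exists B. Qed.

(* The identity as a random element of T with the coarser history sigma-algebra:
   the noise of step k is independent of it. *)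
Definition to_history k (om : T) : history_space k := om.

Lemma measurable_to_history k : measurable_fun setT (to_history k).
Proof. by move=> _ B mB; rewrite setTI; exact: (@history_measurable k). Qed.

HB.instance Definition _ k :=
  isMeasurableFun.Build _ _ T (history_space k) (to_history k) (@measurable_to_history k).

Hypothesis hw : independent_noise w.

Lemma noise_history_indep i k (A : set (history_space k)) (B : set (Xi i)) :
  measurable A -> measurable B ->
  (P (A `&` w i k @^-1` B) = P A * P (w i k @^-1` B))%E.
Proof.
move=> mA mB; rewrite setIC muleC; have := @hw i k.
rewrite /independent_systems; apply; first by exists B => //; rewrite setTI.
move: A mA; apply: smallest_sub; first exact: smallest_sigma_algebra.
move=> A [j [t [tk tA]]]; apply: sub_sigma_algebra.
by exists j, t; split => //; left.
Qed.

Variables (f : 'I_N -> 'cV[R]_d -> R) (L : R).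
Hypothesis L0 : 0 < L.
Hypothesis hf_sm : forall i, lipschitz_gradient L (f i).
Variable g : forall i : 'I_N, 'cV[R]_d -> Xi i -> 'cV[R]_d.
Hypothesis hg : measurable_oracle g.

Lemma sq_lipschitz_grad i : sq_lipschitz (grad (f i)).
Proof. by exists (L ^+ 2); [rewrite sqr_ge0|exact: grad_sq_lipschitz]. Qed.

Lemma vmeas_oracle dS (S : measurableType dS) i (Y : S -> 'cV[R]_d) (v : S -> Xi i) :
  vmeas Y -> measurable_fun setT v -> vmeas (fun s => @g i (Y s) (v s)).
Proof.
move=> mY mv j; have := measurable_fun_pair (vmeas_borel mY) mv.
move=> /(measurableT_comp (@hg i)) /(measurableT_comp (@measurable_cV_coord R d j)).
exact.
Qed.

Variables (x y : nat -> T -> 'cV[R]_(N * d)) (sigma : R).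
Hypothesis hsigma : noise_moments f sigma g w y.

Definition oracle_error i k (om : T) : 'cV[R]_d :=
  @g i (block (y k om) i) (w i k om) - grad (f i) (block (y k om) i).

Definition noise k (om : T) : 'cV[R]_(N * d) := stack (fun i => oracle_error i k om).

Lemma vL2_oracle_error i k : vmeas (y k : history_space k -> _) -> vL2 P (oracle_error i k).
Proof.
move=> /vmeas_history my; split.
  apply: vmeasB; first by apply: vmeas_oracle => //; exact: vmeas_block.
  exact/(vmeas_lip (sq_lipschitz_grad i))/vmeas_block.
(* The conditional variance bound carries the integrability of the squared error. *)
have [_ [Z [iX _ _ _] _]] := hsigma i k.
apply: eq_integrable iX => // om _.
by rewrite /= enorm_sqr.
Qed.

Lemma vL2_noise k : vmeas (y k : history_space k -> _) -> vL2 P (noise k).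
Proof. by move=> my; apply: vL2_stack => i; exact: vL2_oracle_error. Qed.

Lemma integral_sqnorm_noise k : vmeas (y k : history_space k -> _) ->
  (\int[P]_om (sqnorm (noise k om))%:E <= (N%:R * sigma ^+ 2)%:E)%E.
Proof.
move=> my.
have nE om : ((sqnorm (noise k om))%:E = \sum_i (sqnorm (oracle_error i k om))%:E)%E.
  by rewrite sumEFin sqnorm_block; congr EFin; apply: eq_bigr => i _; rewrite block_stack.
under eq_integral do rewrite nE.
rewrite integral_sum// => [|i]; last exact: (vL2_oracle_error i my).2.
have -> : ((N%:R * sigma ^+ 2)%:E = \sum_(i < N) (sigma ^+ 2)%:E :> \bar R)%E.
  by rewrite sumEFin sumr_const card_ord mulr_natl.
apply: lee_sum => i _.
have [_ [Z [_ iZ _ ZE] Zle]] := hsigma i k.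
have -> : (\int[P]_om (sqnorm (oracle_error i k om))%:E = \int[P]_om (Z om)%:E)%E.
  rewrite ZE; first by apply: eq_integral => om _; rewrite enorm_sqr.
  by exists setT => //; rewrite preimage_setT setTI.
rewrite -[leRHS]mule1 -(@probability_setT _ _ _ P) -integral_cst//.
(* [Z] may take negative values; its positive part obeys the same almost sure bound, and
   monotonicity for nonnegative functions applies to it. *)
apply: (@le_trans _ _ (\int[P]_om ((EFin \o Z)^\+ om))%E).
  apply: le_integral => //; first exact: integrable_funepos.
  by move=> om _; rewrite funeposE le_max lexx.
apply: ae_ge0_le_integral => //.
- by apply: measurable_funepos; exact: measurable_int iZ.
- by move=> om _; rewrite lee_fin sqr_ge0.
- move: Zle; apply: filterS => om Zom _.
  by rewrite funeposE ge_max /= !lee_fin Zom sqr_ge0.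
Qed.

(** Coordinate by coordinate, [indep_centered_orthogonal] is applied with the history of step [k] as
    the past, the node's own block of [y k] as the conditioning variable, and a coordinate of [h] as
    multiplier. *)
Lemma integral_dot_noise k (h : T -> 'cV[R]_(N * d)) :
  vmeas (y k : history_space k -> _) -> vmeas (h : history_space k -> _) -> vL2 P h ->
  (\int[P]_om (dot (h om) (noise k om))%:E = 0)%E.
Proof.
move=> my mh h2.
have nL2 := vL2_noise my.
under eq_integral do rewrite /dot -sumEFin.
rewrite integral_sum// => [|p]; last exact: (vL2_coordM_integrable p h2 nL2).
rewrite big1// => p _; case: (mxtens_indexP p) => i j.
pose phi (q : borel_cV (R := R) d * Xi i) : R :=
  @g i q.1 q.2 j 0 - grad (f i) q.1 j 0.
have mphi : measurable_fun setT phi.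
  apply: measurable_funB.
    exact: (measurableT_comp (@measurable_cV_coord R d j) (@hg i)).
  exact: (measurableT_comp (continuous_borel_cV (sq_lipschitz_continuous
    (i := j) (sq_lipschitz_grad i))) measurable_fst).
have eE om : noise k om (mxtens_index (i, j)) 0 = phi (block (y k om) i, w i k om).
  by rewrite /noise mxE mxtens_indexK /= /oracle_error /phi /= !mxE.
have [/(_ j)[iX iZ _ XZ] _] := hsigma i k.
under eq_integral do rewrite eE.
apply: (@indep_centered_orthogonal _ _ _ P _ _ _ (history_space k) (Xi i) (borel_cV (R := R) d)
   (to_history k) (w i k) _ (fun om => block (y k om) i)
   (fun om => h om (mxtens_index (i, j)) 0) phi) => //.
- by move=> A B; exact: noise_history_indep.
- exact/vmeas_borel/vmeas_block.
- by have := integrableB measurableT iX iZ.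
(* On an event of the block of [y k], oracle output and gradient have equal integrals by the
   conditional mean hypothesis. *)
- move=> B mB; set A := _ @^-1` B.
  have mA : measurable A.
    have /vmeas_borel := vmeas_block i (vmeas_history my).
    by move=> /(_ measurableT B mB); rewrite setTI.
  have iX' := integrableS measurableT mA (@subsetT _ _) iX.
  have iZ' := integrableS measurableT mA (@subsetT _ _) iZ.
  have := integralB mA iX' iZ'; rewrite XZ; last by exists B => //; rewrite setTI.
  by rewrite subee ?integrable_fin_num// => <-.
- apply: eq_integrable (vL2_coordM_integrable (mxtens_index (i, j)) h2 nL2) => //.
  by move=> om _; rewrite /= eE.
Qed.

End Process.

Section NoiseDual.
Context {R : realType} {n : nat}.
Variables (G : 'cV[R]_n -> 'cV[R]_n) (alpha q : R) (xinf : 'cV[R]_n).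
Hypothesis lipG : sq_lipschitz G.

Lemma vmeas_extrapolate dS (S : measurableType dS) (x xp : S -> 'cV[R]_n) :
  vmeas x -> vmeas xp -> vmeas (fun s => extrapolate q (x s) (xp s)).
Proof. by move=> mx mxp; apply: vmeasB; exact: vmeasZ. Qed.

Lemma vmeas_noise_dual dS (S : measurableType dS) (x xp : S -> 'cV[R]_n) :
  vmeas x -> vmeas xp -> vmeas (fun s => noise_dual G alpha q xinf (x s) (xp s)).
Proof.
move=> mx mxp; have my := vmeas_extrapolate mx mxp.
have mz : vmeas (fun s => grad_step G alpha (extrapolate q (x s) (xp s))).
  by apply: vmeasB => //; apply: vmeasZ; exact: vmeas_lip my.
apply: vmeasB; last by apply: vmeasZ; exact: vmeas_lip mz.
under eq_fun do rewrite -scaleN1r.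
apply: vmeasZ; apply: vmeasB; first exact: vmeasB mz (vmeas_cst _).
by apply: vmeasZ; exact: vmeasB mx (vmeas_cst _).
Qed.

Context {dT : measure_display} {T : measurableType dT} (P : probability T R).

Lemma vL2_extrapolate (x xp : T -> 'cV[R]_n) :
  vL2 P x -> vL2 P xp -> vL2 P (fun s => extrapolate q (x s) (xp s)).
Proof. by move=> mx mxp; apply: vL2B; exact: vL2Z. Qed.

Lemma vL2_grad_step (y : T -> 'cV[R]_n) :
  vL2 P y -> vL2 P (fun s => grad_step G alpha (y s)).
Proof. by move=> my; apply: vL2B => //; apply: vL2Z; exact: vL2_lip my. Qed.

Lemma vL2_noise_dual (x xp : T -> 'cV[R]_n) : vL2 P x -> vL2 P xp ->
  vL2 P (fun s => noise_dual G alpha q xinf (x s) (xp s)).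
Proof.
move=> mx mxp; have mz := vL2_grad_step (vL2_extrapolate mx mxp).
apply: vL2B; last by apply: vL2Z; exact: vL2_lip mz.
under eq_fun do rewrite -scaleN1r.
apply: vL2Z; apply: vL2B; first exact: vL2B mz (vL2_cst _ _).
by apply: vL2Z; exact: vL2B mx (vL2_cst _ _).
Qed.

End NoiseDual.

Section grad_FpenLipschitz.
Context {R : realType} {N d : nat}.
Variables (L : R) (f : 'I_N -> 'cV[R]_d -> R) (W : 'M[R]_N) (alpha : R).
Hypotheses (L0 : 0 < L) (hf_sm : forall i, lipschitz_gradient L (f i)).

Lemma sq_lipschitz_grad_Fpen : sq_lipschitz (grad_Fpen f W alpha).
Proof.
apply: sq_lipschitzD; last first.
  by exists (L ^+ 2); [rewrite sqr_ge0|exact: grad_Fsum_lipschitz].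
apply: sq_lipschitzZ; apply: sq_lipschitzD; first exact: id_sq_lipschitz.
by under [X in sq_lipschitz X]eq_fun do rewrite -scaleN1r;
  exact/sq_lipschitzZ/sq_lipschitz_mulmx.
Qed.

End grad_FpenLipschitz.

Definition prev {A : Type} (x : nat -> A) (xm1 : A) (k : nat) : A :=
  if k is k'.+1 then x k' else xm1.

Section Iterates.
Context {R : realType} {N d : nat} {dT : measure_display} {T : measurableType dT}.
Variable P : probability T R.
Context {dX : measure_display} {Xi : 'I_N -> measurableType dX}.
Variables (w : forall i : 'I_N, nat -> {RV P >-> Xi i}).
Variables (f : 'I_N -> 'cV[R]_d -> R) (L : R).
Hypotheses (L0 : 0 < L) (hf_sm : forall i, lipschitz_gradient L (f i)).
Variable g : forall i : 'I_N, 'cV[R]_d -> Xi i -> 'cV[R]_d.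
Hypothesis hg : measurable_oracle g.
Variables (W : 'M[R]_N) (alpha q sigma : R) (x0 xm1 : 'cV[R]_(N * d)).
Variables (x y : nat -> T -> 'cV[R]_(N * d)).
Hypothesis alpha0 : 0 < alpha.
Hypothesis hxy : dasg_iterates W alpha ((1 - q) / (1 + q)) g w x0 xm1 x y.
Hypothesis hsigma : noise_moments f sigma g w y.

Local Notation xprev := (prev x (fun=> xm1)).

Lemma y_extrapolate k om : y k om = extrapolate q (x k om) (xprev k om).
Proof. by have [_ -> _] := hxy; case: k. Qed.

(** The factor [alpha] cancels the penalty weight: [y - alpha *: grad_Fpen y] equals
    [W y - alpha *: grad_Fsum y], so an iteration is a perturbed gradient step for the penalized
    objective. *)
Lemma x_step k om : x k.+1 om = grad_step (grad_Fpen f W alpha) alpha (y k om)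
  - alpha *: noise w f g y k om.
Proof.
have [_ _ ->] := hxy; rewrite /grad_step /grad_Fpen scalerDr scalerA mulfV ?gt_eqF//.
have -> : noise w f g y k om = stoch_grad g w k om (y k om) - grad_Fsum f (y k om).
  by apply/colP => i; rewrite !mxE.
by apply/colP => i; rewrite scale1r !mxE; ring.
Qed.

(** The iterate of index [k] uses noise of steps before [k] only; forming the next one brings in the
    noise of step [k], hence the history of index [k.+1]. *)
Lemma x_history k :
  vmeas (x k : history_space w k -> _) /\ vmeas (xprev k : history_space w k -> _).
Proof.
elim: k => [|k [mx mxp]].
  have [hx0 _ _] := hxy; split; last exact: vmeas_cst.
  have -> : x 0%N = fun=> x0 by apply/funext.
  exact: vmeas_cst.
split; last exact: vmeas_history_mono.
have my : vmeas (y k : history_space w k.+1 -> _).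
  apply: vmeas_history_mono; have -> : y k = fun om => extrapolate q (x k om) (xprev k om).
    by apply/funext => om; exact: y_extrapolate.
  exact: vmeas_extrapolate.
have [_ _ hx] := hxy.
have -> : x k.+1 = fun om => bigW W *m y k om - alpha *: stoch_grad g w k om (y k om).
  by apply/funext => om.
apply: vmeasB; first exact: vmeas_lip (sq_lipschitz_mulmx _) my.
apply: vmeasZ; apply: vmeas_stack => i; apply: vmeas_oracle => //.
  exact: vmeas_block.
exact: measurable_noise_history.
Qed.

Lemma y_history k : vmeas (y k : history_space w k -> _).
Proof.
have [mx mxp] := x_history k.
have -> : y k = fun om => extrapolate q (x k om) (xprev k om).
  by apply/funext => om; exact: y_extrapolate.
exact: vmeas_extrapolate.
Qed.

Lemma vL2_x k : vL2 P (x k) /\ vL2 P (xprev k).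
Proof.
elim: k => [|k [mx mxp]].
  have [hx0 _ _] := hxy; split; last exact: vL2_cst.
  have -> : x 0%N = fun=> x0 by apply/funext.
  exact: vL2_cst.
split => //.
have -> : x k.+1 = fun om => grad_step (grad_Fpen f W alpha) alpha
    (extrapolate q (x k om) (xprev k om)) - alpha *: noise w f g y k om.
  by apply/funext => om; rewrite x_step y_extrapolate.
apply: vL2B; last first.
  by apply: vL2Z; apply: (vL2_noise L0 hf_sm hg hsigma); exact: y_history.
apply: (vL2_grad_step _ (sq_lipschitz_grad_Fpen W alpha L0 hf_sm)).
exact: vL2_extrapolate.
Qed.

End Iterates.

(** * Convergence bound *)

Theorem corollary8 (R : realType) (N d : nat) (hN : (1 < N)%N)
  (mu L : R) (hmu : 0 < mu) (hmuL : mu <= L)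
  (f : 'I_N -> 'cV[R]_d -> R)
  (hf_sc : forall i, strongly_convex mu (f i))
  (hf_sm : forall i, lipschitz_gradient L (f i))
  (fmin : 'I_N -> R) (hfmin : forall i, is_min_value (f i) (fmin i))
  (xs : 'cV[R]_d) (hxs : unique_minimizer (average f) xs)
  (E : rel 'I_N) (hE : connected_graph E)
  (W : 'M[R]_N) (hW : mixing_matrix E W)
  (lam : seq R) (hlam : ordered_eigenvalues W lam)
  (hlamN : 0 < lam`_N.-1)
  (alpha : R) (halpha : 0 < alpha <= lam`_N.-1 / L)
  (halpha' : alpha <= 1 / (L + mu))
  (beta : R)
  (hbeta : beta = (1 - Num.sqrt (alpha * mu)) / (1 + Num.sqrt (alpha * mu)))
  (xinf : 'cV[R]_(N * d)) (hxinf : unique_minimizer (Fpen f W alpha) xinf)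
  (dT : measure_display) (T : measurableType dT) (P : probability T R)
  (dX : measure_display) (Xi : 'I_N -> measurableType dX)
  (w : forall i : 'I_N, nat -> {RV P >-> Xi i}) (hw : independent_noise w)
  (g : forall i : 'I_N, 'cV[R]_d -> Xi i -> 'cV[R]_d)
  (hg : measurable_oracle g)
  (x0 xm1 : 'cV[R]_(N * d)) (x y : nat -> T -> 'cV[R]_(N * d))
  (hxy : dasg_iterates W alpha beta g w x0 xm1 x y)
  (sigma : R) (hsigma : noise_moments f sigma g w y) :
  let lamN := lam`_N.-1 in
  let gamma := Num.max `|lam`_1| `|lamN| in
  forall k : nat,
  ('E_P[fun om => (enorm (x k om - stack (fun=> xs)) ^+ 2)%R] <=
    (4 * (1 - Num.sqrt (alpha * mu)) ^+ k
       * (VS f W mu alpha xinf (xi_init x0 xm1 xinf) / mu)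
     + 2 * sigma ^+ 2 * N%:R * Num.sqrt alpha / (mu * Num.sqrt mu)
         * (2 - lamN + alpha * L)
     + 2 * C1 f fmin mu L ^+ 2 * N%:R * alpha ^+ 2 / (1 - gamma) ^+ 2)%:E)%E.
Proof.
move=> lamN gamma k.
have L0 : 0 < L by exact: lt_le_trans hmuL.
have N0 : (0 < N)%N by exact: ltnW.
have [WT Wrow1 _ _] := hW.
have [lamN_le lam1_lt1 W_ge gap] := mixing_spectrum hE hW hN hlam.
rewrite -/lamN in lamN_le W_ge hlamN halpha.
have gammaE : gamma = lam`_1.
  rewrite /gamma !ger0_norm ?(ltW hlamN)//; last exact: le_trans (ltW hlamN) _.
  exact/max_idPl.
have {gammaE lam1_lt1 gap} [gamma1 gap] : gamma < 1 /\ forall u : 'cV[R]_N,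
  \sum_i u i 0 = 0 -> qform W u <= gamma * sqnorm u by rewrite gammaE.
have W_le1 := qform_mixing_le hW.
have /andP[alpha0 alpha_le] := halpha.
have alphaL : alpha * L <= lamN by rewrite -ler_pdivlMr.
have am0 : 0 < alpha * mu by exact: mulr_gt0.
pose q := Num.sqrt (alpha * mu).
have q0 : 0 < q by rewrite sqrtr_gt0.
have q2 : q ^+ 2 = alpha * mu by rewrite sqr_sqrtr// ltW.
have q1 : q <= 1.
  rewrite -sqrtr1 ler_wsqrtr//.
  have : alpha * (L + mu) <= 1 by rewrite -ler_pdivlMr ?addr_gt0.
  have := mulr_gt0 alpha0 L0; rewrite mulrDr; lra.
pose M := Fpen_smoothness L alpha lamN.
have aME : alpha * M = 1 - lamN + alpha * L.
  by rewrite /M /Fpen_smoothness mulrDr mulrA mulfV ?gt_eqF// mul1r.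
(* This is exactly the step-size condition [alpha * L <= lamN]. *)
have aM : alpha * M <= 1 by rewrite aME; lra.
(* Testing both bounds on [W] with the all-ones vector gives [lamN <= 1]. *)
have M0 : 0 < M.
  have aM0 : 0 < alpha * M.
    have := mulr_gt0 alpha0 L0; rewrite aME; have := W_ge (const_mx 1).
    have := W_le1 (const_mx 1) => h1 h2.
    have : lamN * sqnorm (const_mx 1 : 'cV[R]_N) <= 1 * sqnorm (const_mx 1 : 'cV[R]_N).
      by rewrite mul1r; exact: le_trans h2 h1.
    have s0 : 0 < sqnorm (const_mx 1 : 'cV[R]_N).
      rewrite /sqnorm (eq_bigr (fun=> 1)) => [|i _]; last by rewrite mxE expr1n.
      by rewrite sumr_const card_ord ltr0n.
    rewrite ler_pM2r//; lra.
  by rewrite -(pmulr_rgt0 _ alpha0).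
pose Phi := Fpen f W alpha; pose G := grad_Fpen f W alpha.
have lower := Fpen_lower L0 hf_sc hf_sm alpha0 WT W_le1.
have upper := Fpen_upper L0 hf_sm alpha0 WT W_ge.
have Gxinf : G xinf = 0.
  apply: (minimizer_grad0 upper M0) => z; exact: unique_minimizer_le hxinf.
have bias := bias_bound L0 hf_sc hf_sm alpha0 WT W_le1 N0 hmu gamma1 Wrow1 gap
  hfmin hxs hxinf Gxinf.
subst beta.
have hy t om := y_extrapolate hxy t om.
have hx t om := x_step f alpha0 hxy t om.
pose xp := prev x (fun=> xm1).
pose e t om := noise w f g y t om.
pose h t om := noise_dual G alpha q xinf (x t om) (xp t om).
pose U t om := dot (h t om) (e t om)
  + alpha / 2 * (1 + alpha * M) * sqnorm (e t om).
pose V0 := VS f W mu alpha xinf (xi_init x0 xm1 xinf).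
pose B := C1 f fmin mu L ^+ 2 * N%:R * alpha ^+ 2 / (1 - gamma) ^+ 2.
pose b := alpha / 2 * (1 + alpha * M) * (N%:R * sigma ^+ 2).
pose A := 4 * (1 - q) ^+ k * (V0 / mu) + 2 * B.
(* In [4 / mu], a factor 2 comes from splitting the distance at [xinf] and [2 / mu] from strong
   convexity. *)
pose c (t : 'I_k) := 4 / mu * (1 - q) ^+ (k.-1 - t).
have q1' : 0 <= 1 - q by rewrite subr_ge0.
have k0 : 0 <= alpha / 2 * (1 + alpha * M).
  by rewrite !mulr_ge0 ?addr_ge0 ?mulr_ge0 ?invr_ge0// ltW.
have pathwise om : enorm (x k om - stack (fun=> xs)) ^+ 2 <=
    A + \sum_(t < k) c t * U t om.
  have hxS t : x t.+1 om = grad_step G alpha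
      (extrapolate q (x t om) (xp t om)) - alpha *: e t om by rewrite hx hy.
  have := lyap_iter xinf lower upper alpha0 aM (ltW q0) q1 q2
    (x := fun t => x t om) (xp := fun t => xp t om) (e := fun t => e t om)
    hxS (fun=> erefl) k.
  have -> : lyap Phi alpha q xinf (x 0%N om) (xp 0%N om) = V0.
    by have [-> _ _] := hxy; rewrite /V0 VS_lyap.
  move=> hV.
  have hlow := lyap_ge q lower alpha0 (x k om) (xp k om) Gxinf.
  rewrite enorm_sqr.
  have -> : x k om - stack (fun=> xs) = (x k om - xinf) + (xinf - stack (fun=> xs)).
    by rewrite addrA subrK.
  apply: (le_trans (sqnormD_le _ _)).
  have : sqnorm (x k om - xinf) <= 2 / mu * ((1 - q) ^+ k * V0
    + \sum_(t < k) (1 - q) ^+ (k.-1 - t) * U t om).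
    have := le_trans hlow hV.
    rewrite -ler_pdivlMl ?divr_gt0//.
    by rewrite invf_div.
  rewrite /A /c; under [X in _ -> _ <= _ + X]eq_bigr do rewrite -mulrA.
  rewrite -mulr_sumr; set S := \sum_(t < k) _ => hS.
  have -> : 4 * (1 - q) ^+ k * (V0 / mu) + 2 * B + 4 / mu * S =
     2 * (2 / mu * ((1 - q) ^+ k * V0 + S)) + 2 * B by field; rewrite gt_eqF.
  by rewrite lerD// ler_wpM2l.
have my t := y_history hg hxy t.
have x2 t := vL2_x L0 hf_sm hg alpha0 hxy hsigma t.
have lipG : sq_lipschitz G := sq_lipschitz_grad_Fpen W alpha L0 hf_sm.
have e2 t : vL2 P (e t) := vL2_noise L0 hf_sm hg hsigma (my t).
have h2 t : vL2 P (h t) := vL2_noise_dual alpha q xinf lipG (x2 t).1 (x2 t).2.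
have mh t : vmeas (h t : history_space w t -> _).
  have [mx mxp] := x_history hg hxy t.
  exact: (vmeas_noise_dual alpha q xinf lipG mx mxp).
have iU t : P.-integrable setT (EFin \o U t).
  have := integrable_lin 1 (alpha / 2 * (1 + alpha * M))
    (vL2_dot_integrable (h2 t) (e2 t)) (e2 t).2.
  by apply: eq_integrable => // om _; rewrite /= mul1r.
have Ub t : (\int[P]_om (U t om)%:E <= b%:E)%E.
  under eq_integral do rewrite EFinD EFinM.
  have ie : P.-integrable setT (fun om => ((alpha / 2 * (1 + alpha * M))%:E *
    (sqnorm (e t om))%:E)%E) by exact: (integrableZl measurableT _ (e2 t).2).
  rewrite (integralD measurableT (vL2_dot_integrable (h2 t) (e2 t)) ie).
  rewrite (integral_dot_noise hw L0 hf_sm hg hsigma (my t) (mh t) (h2 t)) add0e.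
  rewrite (integralZl measurableT (e2 t).2) /b [leRHS]EFinM.
  apply: lee_wpmul2l; first by rewrite lee_fin.
  exact: (integral_sqnorm_noise L0 hf_sm hg hsigma (my t)).
apply: (@le_trans _ _ (A + \sum_(t < k) c t * b)%:E).
  apply: (@expectation_le_sum _ _ _ P k _ A b c (fun t => U t)) => //.
  - under eq_fun do rewrite enorm_sqr; apply: measurable_sqnorm.
    exact: vmeasB (x2 k).1.1 (vmeas_cst _).
  - by move=> t; rewrite /c mulr_ge0 ?exprn_ge0// divr_ge0 ?ltW.
  - by move=> om; exact: sqr_ge0.
rewrite lee_fin /A -/q -/V0 addrAC lerD//; last by rewrite /B; lra.
rewrite lerD2l -mulr_suml /c -mulr_sumr.
have b0 : 0 <= b by rewrite /b mulr_ge0// mulr_ge0// sqr_ge0.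
(* The weights form a geometric series with sum [(1 - (1 - q) ^+ k) / q]. After this,
   [4 / mu * b / q] is the noise term of the claim. *)
have geo : q * \sum_(t < k) (1 - q) ^+ (k.-1 - t) <= 1.
  have : q * \sum_(t < k) (1 - q) ^+ (k.-1 - t) = 1 - (1 - q) ^+ k.
    elim: (k) => [|n IH]; first by rewrite big_ord0 mulr0 subrr.
    rewrite big_ord_recl/= subn0 mulrDr.
    case: n IH => [|n] IH; first by rewrite big_ord0 expr0 expr1; ring.
    under eq_bigr do rewrite subSS.
    rewrite IH [in RHS]exprS; ring.
  by move=> ->; have := exprn_ge0 k q1'; lra.
have -> : 2 * sigma ^+ 2 * N%:R * Num.sqrt alpha / (mu * Num.sqrt mu) *
    (2 - lamN + alpha * L) = 4 / mu * b / q.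
  have sa : 0 < Num.sqrt alpha by rewrite sqrtr_gt0.
  have sm : 0 < Num.sqrt mu by rewrite sqrtr_gt0.
  rewrite /b aME /q sqrtrM ?ltW//.
  have aE : alpha = Num.sqrt alpha ^+ 2 by rewrite sqr_sqrtr// ltW.
  have -> : 1 + (1 - lamN + alpha * L) = 2 - lamN + alpha * L by ring.
  move: aE sa; set K := 2 - lamN + _; set s := Num.sqrt alpha => aE sa.
  rewrite [in RHS]aE; field.
  by rewrite !gt_eqF.
rewrite ler_pdivlMr//.
have m0 : 0 <= 4 / mu * b by rewrite mulr_ge0// divr_ge0// ltW.
have := ler_wpM2l m0 geo; lra.
Qed.
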